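(* Consider the family (indexed by $\eta\in\mathbb N$) of two-sided queueing systems with $n$ customer types and $n$ server types on a bipartite graph satisfying the perfect matching condition, operated under the two-price policy with $\boldsymbol\theta=\boldsymbol\phi=\mathbf 1_n$: $$\lambda_j(\mathbf q)=\eta\lambda_j^*-\sigma^\eta\,\mathbf 1\{q_j^{(c)}>\tau_{\max}^\eta\},\qquad \mu_i(\mathbf q)=\eta\mu_i^*-\sigma^\eta\,\mathbf 1\{q_i^{(s)}>\tau_{\max}^\eta\}.$$ Then, under any matching policy (for which the system is stable), the stationary expected total queue length satisfies $$\frac{\sigma^\eta}{\eta}\,\mathbb E\Big[\sum_jq_j^{(c)}+\sum_iq_i^{(s)}\Big]\ \ge\ \frac{\sum_j\lambda_j^*+\sum_i\mu_i^*}{2n}-\frac{\sigma^\eta}{\eta}.$$ Furthermore, if the complete resource pooling condition holds, then under max-weight matching, if $\lim_{\eta\to\infty}\sigma^\eta/\eta=0$ and $\lim_{\eta\to\infty}\sigma^\eta\tau_{\max}^\eta/\eta=0$, $$\lim_{\eta\to\infty}\frac{\sigma^\eta}{\eta}\,\mathbb E\Big[\sum_jq_j^{(c)}+\sum_iq_i^{(s)}\Big]=\frac{\sum_j\lambda_j^*+\sum_i\mu_i^*}{2n}.$$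
   Context: **Model.** $N$ is a set of $n$ server types, $M$ a set of $n$ customer types, $E\subseteq N\times M$ the set of compatible pairs. The state $\mathbf q=(q^{(c)}_j;\ q^{(s)}_i)\in\mathbb Z_+^{2n}$ records the numbers of waiting customers and servers of each type. In state $\mathbf q$, type-$j$ customers arrive at Poisson rate $\lambda_j(\mathbf q)$ and type-$i$ servers at Poisson rate $\mu_i(\mathbf q)$. $\sigma^\eta>0$, $\tau_{\max}^\eta\ge0$, and $\eta$ is large enough that all rates are nonnegative. $\mathbb E$ is the stationary expectation. **Matching.** A (stationary) matching policy chooses, as a function of the state, which waiting compatible customer–server pairs to match (each matched pair leaves); i.e. it chooses $\mathbf y\in\mathbb Z_+^{n^2}$ with $\sum_iy_{ij}\le q_j^{(c)}$, $\sum_jy_{ij}\le q_i^{(s)}$, $y_{ij}=0$ for $(i,j)\notin E$, and at the next arrival the state becomes $\mathbf q+\mathbf e-\mathbf x$, where $\mathbf e$ is the unit vector of the arriving type and $x_j^{(c)}=\sum_iy_{ij}$, $x_i^{(s)}=\sum_jy_{ij}$. Stable means that the induced Markov chain has a positive recurrent communicating class containing $\mathbf e_j^{(c)}$ for some $j$. *Max-weight matching* is allowed to match the arrival itself: an arriving server of type $i$ is immediately matched with a waiting customer of a type $j$ maximizing $q_j^{(c)}$ over $\{j:(i,j)\in E\}$ if this maximum is positive; symmetrically for an arriving customer; ties arbitrary; if all compatible queues are empty, the arrival joins its own queue. **Fluid solution.** $(\boldsymbol\lambda^*,\boldsymbol\mu^*,\boldsymbol\chi^* )$ is an optimal solution of: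 maximize $\sum_j\lambda_jF_j(\lambda_j)-\sum_i\mu_iG_i(\mu_i)$ subject to $\lambda_j=\sum_i\chi_{ij}$, $\mu_i=\sum_j\chi_{ij}$, $\chi_{ij}\ge0$ on $E$, $\chi_{ij}=0$ off $E$, where the $F_j$ are strictly decreasing, $G_i$ strictly increasing, $\lambda F_j(\lambda)$ is strictly concave and $\mu G_i(\mu)$ strictly convex; it is assumed $\boldsymbol\lambda^*,\boldsymbol\mu^*>0$. **Perfect matching condition.** $E$ has a perfect matching; without loss of generality server type $i$ is compatible with customer type $i$ for each $i\in\{1,\dots,n\}$. **Complete resource pooling condition.** For all nonempty $J\subsetneq M$ and nonempty $I\subsetneq N$, $\sum_{j\in J}\lambda_j^*<\sum_{i:\exists j\in J,(i,j)\in E}\mu_i^*$ and $\sum_{i\in I}\mu_i^*<\sum_{j:\exists i\in I,(i,j)\in E}\lambda_j^*$. *)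

(* Defs.v *)
From HB Require Import structures.
From mathcomp Require Import all_boot all_order perm all_algebra.
From mathcomp Require Import all_classical all_reals all_analysis.

Set Implicit Arguments.
Unset Strict Implicit.
Unset Printing Implicit Defensive.

Import Order.TTheory GRing.Theory Num.Theory.
Import numFieldNormedType.Exports.

Local Open Scope classical_set_scope.
Local Open Scope ring_scope.

(* Continuous-time Markov chains on a countable space, given by the transition
   rates [r x y] for x != y; the diagonal of [r] is never used. *)
Section MarkovChain.
Context {R : realType} {T : countType}.
Implicit Types (r : T -> T -> R) (x y z : T) (C : set T) (p f : T -> R).

Definition exit_rate r x : \bar R := \esum_(y in [set y | y != x]) (r x y)%:E.

Definition jump_rel r : rel T := fun x y => (y != x) && (0 < r x y).

Definition reaches r x y : Prop :=
  exists s : seq T, path (jump_rel r) x s /\ last x s = y.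

Definition communicating_class r C : Prop :=
  exists x, C = [set y | reaches r x y /\ reaches r y x].

Definition jump_prob r x y : R :=
  if y == x then 0 else r x y / fine (exit_rate r x).

(* Probability that the embedded jump chain started at x is at y after k jumps
   and has not returned to x during the jumps 1, ..., k. *)
Fixpoint taboo_prob r x (k : nat) (y : T) : \bar R :=
  match k with
  | 0%N => (y == x)%:R%:E
  | k'.+1 => if y == x then 0%E else
      \esum_(z in setT) (taboo_prob r x k' z * (jump_prob r z y)%:E)%E
  end.

(* Expectation of the first return time to x: the mean holding times of the
   states visited before the return are added up, that of an absorbing state
   being 0^-1 = +oo in \bar R.  When the exit rates are
   bounded, a positive probability of never returning makes this +oo. *)
Definition mean_return_time r x : \bar R :=
  \esum_(ky in [set: nat * T])
    (taboo_prob r x ky.1 ky.2 * (exit_rate r ky.2)^-1)%E.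

(* An absorbing state counts as positive recurrent. *)
Definition positive_recurrent r x : Prop :=
  exit_rate r x = 0%E \/ (mean_return_time r x < +oo)%E.

(* Probability vector carried by C solving the global balance equations. *)
Definition stationary_law r C p : Prop :=
  [/\ forall x, 0 <= p x,
      \esum_(x in setT) (p x)%:E = 1%E,
      forall x, ~ C x -> p x = 0 &
      forall y, \esum_(x in [set x | x != y]) (p x * r x y)%:E
                = ((p y)%:E * exit_rate r y)%E].

Definition mean p f : \bar R := \esum_(x in setT) (p x * f x)%:E.

End MarkovChain.

(* Customer type j is [inl j] and server type i is [inr i]. *)
Notation agent n := ('I_n + 'I_n)%type.
Notation state n := {ffun 'I_n + 'I_n -> nat}.

Section TwoSidedQueue.
Context {R : realType} {n : nat}.
(* An element (i, j) of E pairs the server type i with the customer type j. *)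
Implicit Types (E : {set 'I_n * 'I_n}) (q : state n) (a b : agent n).

Definition add_agent q a : state n := [ffun b => (q b + (b == a))%N].
Definition remove_agent q a : state n := [ffun b => (q b - (b == a))%N].

Definition unit_state a : state n := [ffun b => (b == a) : nat].

Definition total_queue q : R :=
  \sum_(j < n) (q (inl j))%:R + \sum_(i < n) (q (inr i))%:R.

Definition perfect_matching E : Prop :=
  exists s : {perm 'I_n}, forall i, (i, s i) \in E.

Definition resource_pooling E (lam mu : 'I_n -> R) : Prop :=
  (forall J : {set 'I_n}, J != finset.set0 -> J \proper finset.setT ->
     \sum_(j in J) lam j < \sum_(i | [exists j in J, (i, j) \in E]) mu i) /\
  (forall I : {set 'I_n}, I != finset.set0 -> I \proper finset.setT ->
     \sum_(i in I) mu i < \sum_(j | [exists i in I, (i, j) \in E]) lam j).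

(* [arr q a] is the arrival rate of type a in state q, and [step q a] the state
   reached from q at such an arrival. *)
Definition chain_rate (arr : state n -> agent n -> R)
    (step : state n -> agent n -> state n) (q q' : state n) : R :=
  \sum_(a | step q a == q') arr q a.

Definition two_price (lam mu : 'I_n -> R) (eta sigma tau : R) q a : R :=
  eta * (match a with inl j => lam j | inr i => mu i end)
  - sigma * (tau < (q a)%:R)%R%:R.

Definition matched (y : 'M[nat]_n) a : nat :=
  match a with
  | inl j => (\sum_(i < n) y i j)%N
  | inr i => (\sum_(j < n) y i j)%N
  end.

Definition matching_policy E (y : state n -> 'M[nat]_n) : Prop :=
  forall q, (forall a, (matched (y q) a <= q a)%N) /\
            (forall i j, (i, j) \notin E -> y q i j = 0%N).

(* The matching y q is chosen in state q, before the arrival that triggers it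
   is known, so it never uses the arriving agent and the subtraction is exact
   for a matching policy. *)
Definition policy_step (y : state n -> 'M[nat]_n) q a : state n :=
  [ffun b => (add_agent q a b - matched (y q) b)%N].

Definition compatible E a b : bool :=
  match a, b with
  | inl j, inr i => (i, j) \in E
  | inr i, inl j => (i, j) \in E
  | _, _ => false
  end.

(* Unlike in [policy_step], the arriving agent itself may be matched: its
   partner b leaves and the arrival never joins its queue. *)
Definition max_weight_move E q a (q' : state n) : Prop :=
  (exists b, [/\ compatible E a b, (0 < q b)%N,
                 forall b', compatible E a b' -> (q b' <= q b)%N &
                 q' = remove_agent q b]) \/
  ((forall b, compatible E a b -> q b = 0%N) /\ q' = add_agent q a).

(* Any choice function among the maximal queues is a tie-breaking rule. *)
Definition max_weight E (step : state n -> agent n -> state n) : Prop :=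
  forall q a, max_weight_move E q a (step q a).

Definition stable_class (r : state n -> state n -> R) (C : set (state n)) :=
  [/\ communicating_class r C,
      forall q, C q -> positive_recurrent r q &
      exists j : 'I_n, C (unit_state (inl j))].

End TwoSidedQueue.

Section FluidProblem.
Context {R : realType} {n : nat}.
Implicit Types (E : {set 'I_n * 'I_n}) (F G : 'I_n -> R -> R).
Implicit Types (lam mu : 'I_n -> R) (chi : 'M[R]_n) (f : R -> R).

(* Rates are nonnegative, so price curves are only constrained on [0, +oo[. *)
Definition strictly_increasing f : Prop :=
  forall x y : R, 0 <= x -> x < y -> f x < f y.

Definition strictly_decreasing f : Prop :=
  forall x y : R, 0 <= x -> x < y -> f y < f x.

Definition strictly_convex f : Prop :=
  forall x y t : R, 0 <= x -> 0 <= y -> x != y -> 0 < t < 1 ->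
    f (t * x + (1 - t) * y) < t * f x + (1 - t) * f y.

Definition strictly_concave f : Prop := strictly_convex (fun x => - f x).

Definition price_curves F G : Prop :=
  [/\ forall j, strictly_decreasing (F j),
      forall i, strictly_increasing (G i),
      forall j, strictly_concave (fun x => x * F j x) &
      forall i, strictly_convex (fun x => x * G i x)].

Definition fluid_feasible E lam mu chi : Prop :=
  [/\ forall j, lam j = \sum_(i < n) chi i j,
      forall i, mu i = \sum_(j < n) chi i j,
      forall i j, (i, j) \in E -> 0 <= chi i j &
      forall i j, (i, j) \notin E -> chi i j = 0].

Definition fluid_profit F G lam mu : R :=
  \sum_(j < n) lam j * F j (lam j) - \sum_(i < n) mu i * G i (mu i).

Definition fluid_optimal E F G lam mu chi : Prop :=
  fluid_feasible E lam mu chi /\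
  forall lam' mu' chi', fluid_feasible E lam' mu' chi' ->
    fluid_profit F G lam' mu' <= fluid_profit F G lam mu.

End FluidProblem.

(* Main.v *)
(* Let T be the total queue length, D the number of waiting customers minus that
   of waiting servers, and B the number of customer types above the threshold
   minus that of server types.  A match does not change D, so D^2 has drift
   (total arrival rate) - 2 sigma D B, and |D B| <= n T gives the lower bound in
   stationarity.

   Under max-weight matching and complete resource pooling, the sum of the
   squared queue lengths has drift at most eta W - 2 eta H, where W is the sum
   of all fluid rates and H >= 0 dominates the spread of the queues on either
   side.  Hence the queues of one side are nearly equal and those of the other
   side nearly empty, so that n T - D B = O(tau + H).  Adding the sum of squares
   to D^2 with weight of order sigma / eta absorbs H, and a single Lyapunov
   function yields both the sharp upper bound and, through tightness, the
   existence of a stationary law. *)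
Require Import Defs.
From mathcomp Require Import all_boot all_order perm all_algebra.
From mathcomp Require Import all_classical all_reals all_analysis.
From mathcomp Require Import finmap ring lra.

Set Implicit Arguments.
Unset Strict Implicit.
Unset Printing Implicit Defensive.

Import Order.TTheory GRing.Theory Num.Theory.
Import numFieldNormedType.Exports.

Local Open Scope classical_set_scope.
Local Open Scope ring_scope.

(** * Sums of nonnegative families *)

Section SumTools.
Context {R : realType}.

Lemma le_esum_seq (T : choiceType) (f : T -> \bar R) (s : seq T) :
  uniq s -> (\sum_(x <- s) f x <= \esum_(x in setT) f x)%E.
Proof.
move=> us; rewrite esum_ge//; exists [set` s]; first by split.
by rewrite -fsbig_seq.
Qed.

Lemma esum_le_seq (T : choiceType) (f : T -> \bar R) (c : \bar R) :
  (forall s : seq T, uniq s -> (\sum_(x <- s) f x <= c)%E) ->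
  (\esum_(x in setT) f x <= c)%E.
Proof.
move=> fc; apply: ge_ereal_sup => _ [X [finX _]] <-.
by rewrite fsbig_finite//=; apply: fc; exact: fset_uniq.
Qed.

(** Finite sums give one inequality for every nonnegative factor; the same inequality with the
    factor [c^-1] gives the converse. *)
Lemma esumZ (T : choiceType) (c : R) (f : T -> \bar R) :
  0 <= c -> (forall x, 0 <= f x)%E ->
  \esum_(x in setT) (c%:E * f x)%E = (c%:E * \esum_(x in setT) f x)%E.
Proof.
have half (d : R) (g : T -> \bar R) : 0 <= d -> (forall x, 0 <= g x)%E ->
    (\esum_(x in setT) (d%:E * g x) <= d%:E * \esum_(x in setT) g x)%E.
  move=> d0 g0; apply: esum_le_seq => s us.
  by rewrite -ge0_sume_distrr// lee_wpmul2l ?lee_fin// le_esum_seq.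
move=> c0 f0; apply/eqP; rewrite eq_le half//=.
have [->|cn0] := eqVneq c 0.
  by rewrite mul0e esum_ge0// => x _; rewrite mul0e.
have cp : 0 < c by rewrite lt_neqAle eq_sym cn0.
rewrite -[leRHS]mul1e -(divff cn0) EFinM -muleA lee_wpmul2l ?lee_fin//.
have cf0 x : (0 <= c%:E * f x)%E by rewrite mule_ge0// lee_fin.
apply: le_trans (half c^-1 _ _ cf0); last by rewrite invr_ge0.
by apply: le_esum => x _; rewrite muleA -EFinM mulVf// mul1e.
Qed.

Lemma esum_swap (T T' : choiceType) (f : T -> T' -> \bar R) :
  (forall x y, 0 <= f x y)%E ->
  \esum_(x in setT) \esum_(y in setT) f x y =
  \esum_(y in setT) \esum_(x in setT) f x y.
Proof.
have half (S S' : choiceType) (g : S -> S' -> \bar R) :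
    (forall x y, 0 <= g x y)%E ->
    (\esum_(x in setT) \esum_(y in setT) g x y <=
     \esum_(y in setT) \esum_(x in setT) g x y)%E.
  move=> g0; apply: esum_le_seq => s us; rewrite -esum_sum//.
  by apply: le_esum => y _; exact: le_esum_seq.
by move=> f0; apply/eqP; rewrite eq_le !half.
Qed.

Lemma esum_finType (G : finType) (T : choiceType) (h : G -> T)
    (f : T -> \bar R) :
  injective h -> (forall x, 0 <= f x)%E ->
  (forall x, f x != 0%E -> exists g, x = h g) ->
  \esum_(x in setT) f x = (\sum_g f (h g))%E.
Proof.
move=> hinj f0 fh.
have eqs : (\sum_g f (h g) = \sum_(x <- [seq h g | g <- enum G]) f x)%E.
  by rewrite big_map big_enum.
rewrite eqs; apply/eqP; rewrite eq_le; apply/andP; split; last first.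
  by rewrite le_esum_seq// map_inj_uniq// enum_uniq.
apply: esum_le_seq => s us.
rewrite (bigID [in map h (enum G)])/=.
rewrite [X in (_ + X)%E]big1 ?adde0; last first.
  move=> x; apply: contraNeq => /fh[g ->].
  by rewrite map_f// mem_enum.
rewrite [leRHS](bigID [in s])/= -[leLHS]adde0 leeD ?sume_ge0//.
rewrite -[leRHS]big_filter -[leLHS]big_filter.
rewrite (perm_big [seq x <- map h (enum G) | x \in s])//.
apply: uniq_perm; rewrite ?filter_uniq ?map_inj_uniq -?enumT ?enum_uniq//.
by move=> x; rewrite !mem_filter andbC.
Qed.

Lemma esum_pred1 (T : choiceType) (x : T) (f : T -> \bar R) :
  (forall y, 0 <= f y)%E -> (forall y, y != x -> f y = 0%E) ->
  \esum_(y in setT) f y = f x.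
Proof.
move=> f0 fx; rewrite (@esum_finType unit _ (fun=> x)) ?big_const ?card_unit//=.
- by rewrite adde0.
- by move=> [] [].
- by move=> y; case: (eqVneq y x) => [->|/fx->]; [exists tt|rewrite eqxx].
Qed.

Lemma esumD1 (T : choiceType) (x : T) (f : T -> \bar R) :
  (forall y, 0 <= f y)%E ->
  (\esum_(y in setT) f y = f x + \esum_(y in [set y | y != x]) f y)%E.
Proof.
move=> f0; rewrite (esumID [set x])// !setTI esum_set1//.
by congr (_ + esum _ _)%E; apply/seteqP; split=> y /= /eqP.
Qed.

End SumTools.

(** * Stationarity and drift *)

Section Chain.
Context {R : realType} {n : nat}.
Implicit Types (arr : state n -> agent n -> R).
Implicit Types (step : state n -> agent n -> state n) (p f g : state n -> R).

Definition total_rate arr (q : state n) : R := \sum_a arr q a.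

(** The generator of the chain applied to [f]; self-loops [step q a = q] contribute 0. *)
Definition drift arr step f (q : state n) : R :=
  \sum_a arr q a * (f (step q a) - f q).

Lemma chain_rate_ge0 arr step : (forall q a, 0 <= arr q a) ->
  forall q q', 0 <= chain_rate arr step q q'.
Proof. by move=> arr0 q q'; apply: sumr_ge0. Qed.

Lemma esum_chain_rate arr step g q :
  (forall q a, 0 <= arr q a) -> (forall y, 0 <= g y) ->
  \esum_(y in setT) (chain_rate arr step q y * g y)%:E =
  (\sum_a arr q a * g (step q a))%:E.
Proof.
move=> arr0 g0.
transitivity (\esum_(y in setT) \sum_a
    (if step q a == y then (arr q a * g y)%:E else 0%E))%E.
  by apply: eq_esum => y _; rewrite /chain_rate mulr_suml -sumEFin big_mkcond.
rewrite esum_sum; last first.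
  by move=> y a _ _; case: ifP => // _; rewrite lee_fin mulr_ge0.
rewrite -sumEFin; apply: eq_bigr => a _; rewrite (esum_pred1 (x := step q a)).
- by rewrite eqxx.
- by move=> y; case: ifP => // _; rewrite lee_fin mulr_ge0.
- by move=> y; rewrite eq_sym => /negPf->.
Qed.

Lemma exit_rateE arr step q : (forall q a, 0 <= arr q a) ->
  exit_rate (chain_rate arr step) q =
  (total_rate arr q - chain_rate arr step q q)%:E.
Proof.
move=> arr0; have r0 := chain_rate_ge0 step arr0.
have := esum_chain_rate step q arr0 (fun=> ler01).
rewrite (esumD1 q); last by move=> y; rewrite mulr1 lee_fin.
under eq_bigr do rewrite mulr1.
under eq_esum do rewrite mulr1.
rewrite mulr1 -/(exit_rate _ q) EFinB => <-.
by rewrite addeAC subee// add0e.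
Qed.

Lemma stationary_law_balance arr step C p y :
  (forall q a, 0 <= arr q a) ->
  stationary_law (chain_rate arr step) C p ->
  \esum_(x in setT) (p x * chain_rate arr step x y)%:E =
  (p y * total_rate arr y)%:E.
Proof.
move=> arr0 [p0 _ _ /(_ y) bal]; rewrite (esumD1 y).
  by rewrite bal exit_rateE// -EFinM -EFinD mulrBr addrC subrK.
by move=> x; rewrite lee_fin mulr_ge0// chain_rate_ge0.
Qed.

(* Valid for every nonnegative f: both sides may be infinite. *)
Lemma stationary_law_test arr step C p f :
  (forall q a, 0 <= arr q a) -> (forall q, 0 <= f q) ->
  stationary_law (chain_rate arr step) C p ->
  mean p (fun q => \sum_a arr q a * f (step q a)) =
  mean p (fun q => total_rate arr q * f q).
Proof.
move=> arr0 f0 st; have [p0 _ _ _] := st; rewrite /mean.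
have r0 := chain_rate_ge0 step arr0.
transitivity (\esum_(q in setT) \esum_(y in setT)
    (p q * (chain_rate arr step q y * f y))%:E).
  apply: eq_esum => q _; rewrite EFinM -(esum_chain_rate step q arr0 f0) -esumZ//.
  by move=> y; rewrite lee_fin mulr_ge0.
rewrite esum_swap; last by move=> x y; rewrite lee_fin !mulr_ge0.
apply: eq_esum => y _; rewrite mulrA [RHS]EFinM muleC.
rewrite -(stationary_law_balance y arr0 st) -esumZ//.
  by apply: eq_esum => x _; rewrite -EFinM mulrA mulrC.
by move=> x; rewrite lee_fin mulr_ge0.
Qed.

(** A Foster-Lyapunov comparison in which [f] may fail to be integrable. Truncating [f] at a level
    [K] above its values on a finite set [s] keeps the drift bound where [f < K] and makes the drift
    nonpositive elsewhere, where [h >= 0] suffices. The truncation is bounded, so its drift averages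
    to 0, and the sum of [p * g] over [s] is at most [mean p h]. *)
Lemma mean_comparison arr step C p f g h (L : R) :
  (forall q a, 0 <= arr q a) -> (forall q, total_rate arr q <= L) ->
  (forall q, 0 <= f q) -> (forall q, 0 <= g q) -> (forall q, 0 <= h q) ->
  stationary_law (chain_rate arr step) C p ->
  (forall q, C q -> drift arr step f q <= h q - g q) ->
  (mean p g <= mean p h)%E.
Proof.
move=> arr0 arrL f0 g0 h0 st dr; have [p0 p1 pC _] := st.
have L0 : 0 <= L by apply: le_trans (arrL [ffun=> 0%N]); apply: sumr_ge0.
apply: esum_le_seq => s us.
pose K : R := 1 + \sum_(q <- s) f q.
have K0 : 0 <= K by rewrite addr_ge0// sumr_ge0.
have fK q : q \in s -> f q < K.
  move=> qs; rewrite /K (big_rem q)//= addrCA ltrDl ltr_pwDl//.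
  by rewrite sumr_ge0.
pose fc q := Num.min (f q) K.
have fc0 q : 0 <= fc q by rewrite le_min f0.
pose g' q : R := (f q < K)%R%:R * g q.
have g'0 q : 0 <= g' q by rewrite mulr_ge0.
pose u q := \sum_a arr q a * fc (step q a).
pose v q := total_rate arr q * fc q.
have u0 q : 0 <= u q by apply: sumr_ge0 => a _; rewrite mulr_ge0.
have v0 q : 0 <= v q by rewrite mulr_ge0// sumr_ge0.
have uv q : C q -> u q + g' q <= v q + h q.
  move=> Cq; have := dr q Cq; rewrite /g' /u /v /fc /drift.
  have [fqK|Kfq] := ltrP (f q) K.
    rewrite mul1r => {}dr.
    have : \sum_a arr q a * Num.min (f (step q a)) K <=
           \sum_a arr q a * (f (step q a) - f q) + total_rate arr q * f q.
      rewrite /total_rate mulr_suml -big_split; apply: ler_sum => a _ /=.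
      by rewrite -mulrDr subrK ler_wpM2l// ge_min lexx.
    lra.
  rewrite mul0r => _.
  have : \sum_a arr q a * Num.min (f (step q a)) K <= total_rate arr q * K.
    rewrite /total_rate mulr_suml; apply: ler_sum => a _.
    by rewrite ler_wpM2l// ge_min lexx orbT.
  have := h0 q; lra.
have muv : mean p u = mean p v by exact: stationary_law_test st.
(* This mean is at most [L * K], so it can be cancelled below. *)
have mv : mean p v \is a fin_num.
  rewrite ge0_fin_numE; last by apply: esum_ge0 => q _; rewrite lee_fin mulr_ge0.
  apply: (@le_lt_trans _ _ (\esum_(q in setT) ((L * K)%:E * (p q)%:E))%E).
    apply: le_esum => q _; rewrite -EFinM lee_fin mulrC ler_wpM2r//.
    by rewrite ler_pM// ?sumr_ge0// ge_min lexx orbT.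
  by rewrite esumZ ?p1 ?mule1 ?ltry// ?mulr_ge0// => q; rewrite lee_fin.
have : (mean p u + mean p g' <= mean p v + mean p h)%E.
  rewrite /mean -!esumD; try by move=> q _; rewrite lee_fin mulr_ge0.
  apply: le_esum => q _; rewrite -!EFinD lee_fin -!mulrDr.
  have [Cq|nCq] := pselect (C q); first by rewrite ler_wpM2l// uv.
  by rewrite pC// !mul0r.
rewrite muv leeD2lE//; apply: le_trans.
apply: le_trans (le_esum_seq _ us); rewrite big_seq [leRHS]big_seq.
by apply: lee_sum => q qs; rewrite lee_fin /g' fK// mul1r.
Qed.

End Chain.

(** * Existence of stationary laws *)

Section Existence.
Context {R : realType} {n : nat}.
Implicit Types (q : state n) (a : agent n).

Lemma fmap_ultra (T U : Type) (f : T -> U) (F : set_system T) :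
  UltraFilter F -> UltraFilter (f @ F).
Proof.
move=> FU; split => [|G GP FG]; first exact: fmap_proper_filter.
apply/seteqP; split=> [B GB|]; last exact: FG.
have [//|nB] := in_ultra_setVsetC (f @^-1` B) FU.
have /filter_not_empty[] : G set0.
by rewrite -(setICr B); apply: filterI => //; exact: FG.
Qed.

(** Compactness of the segment. Limits along a single ultrafilter serve all states at once, in place
    of a diagonal extraction. *)
Lemma ultra_bounded_cvg (F : set_system nat) (u : nat -> R) (a b : R) :
  UltraFilter F -> (forall k, a <= u k <= b) -> exists l : R, u @ F --> l.
Proof.
move=> FU uab; have := @segment_compact R a b.
rewrite compact_ultra => /(_ _ (fmap_ultra u FU)) [].
  by apply: (@filterE _ F) => k; rewrite /= in_itv/=.
by move=> l [_ ul]; exists l.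
Qed.

Definition qsize q : nat := (\sum_a q a)%N.

Lemma total_queueE q : total_queue q = (qsize q)%:R :> R.
Proof. by rewrite /qsize big_sumType natrD !natr_sum. Qed.

(** A finite index type for a box containing every state of size at most [m], so that sums over
    small states become finite. *)
Definition box_state m (g : {ffun agent n -> 'I_m.+1}) : state n :=
  [ffun a => val (g a)].

Lemma box_state_inj m : injective (@box_state m).
Proof.
move=> g h /ffunP gh; apply/ffunP => a; apply: val_inj.
by have := gh a; rewrite !ffunE.
Qed.

Lemma box_stateP m q : (qsize q <= m)%N -> exists g, q = box_state (m := m) g.
Proof.
move=> qm; exists [ffun a => inord (q a)]; apply/ffunP => a.
rewrite !ffunE/= inordK// ltnS (leq_trans _ qm)// /qsize (bigD1 a)//=.
exact: leq_addr.
Qed.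

Context (arr : state n -> agent n -> R) (step : state n -> agent n -> state n).
Context (S : set (state n)) (q0 : state n) (f : state n -> R) (L B c : R).
Hypothesis arr0 : forall q a, 0 <= arr q a.
Hypothesis arrL : forall q, total_rate arr q <= L.
Hypothesis L0 : 0 < L.
Hypothesis Sq0 : S q0.
Hypothesis Sstep : forall q a, S q -> S (step q a).
Hypothesis f0 : forall q, 0 <= f q.
Hypothesis c0 : 0 < c.
Hypothesis fdrift : forall q, S q ->
  drift arr step f q <= B - c * (qsize q)%:R.
Hypothesis step_size : forall q a, (qsize q <= (qsize (step q a)).+1)%N.

(* Transition operator of the uniformised chain, whose jumps occur at rate L. *)
Let P (g : state n -> R) q : R := g q + L^-1 * drift arr step g q.

(** As [total_rate] is at most [L], all coefficients here are nonnegative, which makes [P]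
    monotone. *)
Let PE g q : P g q =
  (1 - L^-1 * total_rate arr q) * g q + L^-1 * \sum_a arr q a * g (step q a).
Proof.
rewrite /P mulrBl mul1r -addrA -mulrA -mulNr mulNr -mulrN -mulrDr; congr (_ + _ * _).
rewrite /total_rate mulr_suml -sumrN -big_split; apply: eq_bigr => a _ /=.
ring.
Qed.

Let P_le g h : (forall q, S q -> g q <= h q) -> forall q, S q -> P g q <= P h q.
Proof.
move=> gh q Sq; rewrite !PE lerD ?ler_wpM2l ?gh//.
- by rewrite subr_ge0 mulrC ler_pdivrMr ?mul1r.
- by rewrite invr_ge0 ltW.
- by apply: ler_sum => a _; rewrite ler_wpM2l// gh//; exact: Sstep.
Qed.

Let PD g h (k : R) : P (fun q => g q + k * h q) = fun q => P g q + k * P h q.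
Proof.
apply/funext => q; rewrite !PE.
have -> : \sum_a arr q a * (g (step q a) + k * h (step q a)) =
    \sum_a arr q a * g (step q a) + k * \sum_a arr q a * h (step q a).
  by rewrite mulr_sumr -big_split; apply: eq_bigr => a _ /=; ring.
ring.
Qed.

Let P1 k : P (fun=> k) = fun=> k.
Proof.
apply/funext => q; rewrite /P /drift big1 ?mulr0 ?addr0// => a _.
by rewrite subrr mulr0.
Qed.

Let iterP_le i g h : (forall q, S q -> g q <= h q) ->
  forall q, S q -> iter i P g q <= iter i P h q.
Proof. by move=> gh; elim: i => //= i; exact: P_le. Qed.

Let iterPD i g h k :
  iter i P (fun q => g q + k * h q) = fun q => iter i P g q + k * iter i P h q.
Proof. by elim: i => //= i ->; rewrite PD. Qed.

Let iterP1 i k : iter i P (fun=> k) = fun=> k.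
Proof. by elim: i => //= i ->; rewrite P1. Qed.

(** [iter i P g q0] is the expectation of [g] after [i] steps of the uniformised chain started at
    [q0]; [A k] averages it over the times 0 to [k]. *)
Let A k (g : state n -> R) : R := k.+1%:R^-1 * \sum_(i < k.+1) iter i P g q0.

Let k0 k : 0 < k.+1%:R^-1 :> R. Proof. by rewrite invr_gt0 ltr0n. Qed.

Let A_le k g h : (forall q, S q -> g q <= h q) -> A k g <= A k h.
Proof.
move=> gh; rewrite ler_wpM2l ?(ltW (k0 k))//; apply: ler_sum => i _.
exact: iterP_le.
Qed.

Let A1 k l : A k (fun=> l) = l.
Proof.
rewrite /A; under eq_bigr do rewrite iterP1.
by rewrite sumr_const card_ord -[l *+ _]mulr_natl mulrA mulVf ?mul1r// pnatr_eq0.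
Qed.

Let AD k g h l : A k (fun q => g q + l * h q) = A k g + l * A k h.
Proof.
rewrite /A mulrCA -mulrDr; congr (_ * _). rewrite mulr_sumr -big_split. 
by apply: eq_bigr => i _; rewrite iterPD.
Qed.

(** The sum telescopes. For [g = delta y] the right side is of order 1/k, so limits of the averages
    are invariant under [P]. *)
Let AP k g : A k (P g) - A k g = k.+1%:R^-1 * (iter k.+1 P g q0 - g q0).
Proof.
rewrite /A -mulrBr; congr (_ * _); rewrite -sumrB.
elim: k => [|k IH]; first by rewrite big_ord1.
by rewrite big_ord_recr/= IH -iterS -iterSr /= addrC addrA subrK.
Qed.

Let A_sum k (I : Type) (s : seq I) (l : I -> R) (h : I -> state n -> R) :
  A k (fun q => \sum_(i <- s) l i * h i q) = \sum_(i <- s) l i * A k (h i).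
Proof.
elim: s => [|i s IH].
  by rewrite big_nil -[RHS](A1 k); congr A; apply/funext => q; rewrite big_nil.
rewrite big_cons -IH addrC -AD; congr A.
by apply/funext => q; rewrite big_cons addrC.
Qed.

(** The averaged [fdrift] bounds [A k (P f) - A k f] from above; telescoping and [f >= 0] bound it
    from below by [- f q0]. *)
Let size_bound k : A k (fun q => (qsize q)%:R) <= (B + L * f q0) / c.
Proof.
have LV : 0 < L^-1 by rewrite invr_gt0.
have : A k (P f) <= A k (fun q => f q + L^-1 * (B + (- c) * (qsize q)%:R)).
  apply: A_le => q Sq; rewrite lerD2l ler_wpM2l ?(ltW LV)//.
  by rewrite mulNr fdrift.
rewrite (AD k f (fun q => B + (- c) * (qsize q)%:R) L^-1).
rewrite (AD k (fun=> B) (fun q => (qsize q)%:R) (- c)) (A1 k B) => h.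
have h1 : - f q0 <= A k (P f) - A k f.
  rewrite AP mulrBr -[leLHS]add0r lerD//.
    rewrite mulr_ge0 ?(ltW (k0 k))//.
    by have := iterP_le k.+1 (fun q _ => f0 q) Sq0; rewrite iterP1.
  by rewrite lerN2 ler_piMl// invf_le1 ?ler1n ?ltr0n.
rewrite ler_pdivlMr// mulrC.
have h2 : L^-1 * (c * A k (fun q => (qsize q)%:R)) <= L^-1 * (B + L * f q0).
  rewrite mulrDr mulKf ?gt_eqF//; move: h h1.
  move: (A k _) (A k _) (A k _) => x y z; rewrite mulrDr mulNr mulrN; lra.
by rewrite ler_pM2l in h2.
Qed.

Let delta (y : state n) q : R := (q == y)%:R.

Let A_delta k y : 0 <= A k (delta y) <= 1.
Proof.
apply/andP; split; [rewrite -[leLHS](A1 k)|rewrite -[leRHS](A1 k)];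
by apply: A_le => q _; rewrite /delta; case: eqP.
Qed.

Let P_delta y q :
  P (delta y) q = delta y q + L^-1 *
    (chain_rate arr step q y - total_rate arr q * delta y q).
Proof.
congr (_ + _ * _); rewrite /drift /total_rate /chain_rate mulr_suml.
rewrite [X in _ = X - _]big_mkcond -sumrB; apply: eq_bigr => a _.
by rewrite mulrBr /delta; case: eqP => _; rewrite ?mulr1 ?mulr0.
Qed.

Let sum_delta_seq (s : seq (state n)) q :
  uniq s -> \sum_(y <- s) delta y q = (q \in s)%:R.
Proof.
elim: s => [_|y s IH /= /andP[ys us]]; first by rewrite big_nil.
rewrite big_cons IH// in_cons /delta; case: eqP => [->|_]; last by rewrite add0r.
by rewrite (negPf ys) addr0.
Qed.

(** Through such a finite combination of point masses, convergence of the averages of each [delta y]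
    carries over to [g]. *)
Let expand m (g : state n -> R) : (forall q, g q != 0 -> (qsize q <= m)%N) ->
  g = fun q => \sum_(b : {ffun agent n -> 'I_m.+1})
    g (box_state b) * delta (box_state b) q.
Proof.
move=> gm; apply/funext => q; have [qm|] := boolP (qsize q <= m)%N; last first.
  move=> qm; have -> : g q = 0 by apply: contraNeq qm; exact: gm.
  rewrite big1// => b _; rewrite /delta; case: eqP => [<-|]; last by rewrite mulr0.
  by rewrite mulr1; apply: contraNeq qm; exact: gm.
have [b ->] := box_stateP qm.
rewrite (bigD1 b)//= /delta eqxx mulr1 big1 ?addr0// => b' b'b.
case: eqP => [/box_state_inj bb'|]; last by rewrite mulr0.
by rewrite bb' eqxx in b'b.
Qed.

(* A limit of the Cesaro averages of the law at times 0, ..., k; no mass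
   escapes to infinity because their mean queue lengths are bounded. *)
Lemma stationary_law_exists :
  exists p, stationary_law (chain_rate arr step) S p.
Proof.
have [U [UU oU]] := ultraFilterLemma eventually_filter.
have PU : ProperFilter U := @ultra_proper _ _ UU.
have /choice[p pP] : forall y, exists l : R, (fun k => A k (delta y)) @ U --> l.
  by move=> y; apply: ultra_bounded_cvg => k; exact: A_delta.
have p0 y : 0 <= p y.
  apply: (cvgr_to_ge (pP y)); apply: filterE => k.
  by have /andP[] := A_delta k y.
have limA (I : Type) (s : seq I) (l : I -> R) (y : I -> state n) :
    (fun k => A k (fun q => \sum_(i <- s) l i * delta (y i) q)) @ U -->
    \sum_(i <- s) l i * p (y i).
  have -> : (fun k => A k (fun q => \sum_(i <- s) l i * delta (y i) q)) =
      fun k => \sum_(i <- s) l i * A k (delta (y i)).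
    by apply/funext => k; rewrite A_sum.
  elim: s => [|i s IH].
    by rewrite big_nil; under eq_cvg do rewrite big_nil; exact: cvg_cst.
  rewrite big_cons; under eq_cvg do rewrite big_cons.
  by apply: cvgD => //; apply: cvgMr; exact: pP.
(* A step lowers the size by at most one, so only states of size at most [(qsize y).+1] jump to [y].
   Hence [P (delta y)] has finite support, and its invariance in the limit is the balance equation
   at [y]. *)
have bal y : \esum_(x in setT) (p x * chain_rate arr step x y)%:E =
    (p y * total_rate arr y)%:E.
  have r0 := chain_rate_ge0 step arr0.
  pose m := (qsize y).+1.
  have rm x : chain_rate arr step x y != 0 -> (qsize x <= m)%N.
    move=> /eqP rxy; rewrite leqNgt; apply/negP => mx; apply: rxy.
    rewrite /chain_rate big1// => a /eqP xa.
    by have := step_size x a; rewrite xa => /(leq_trans mx); rewrite ltnn.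
  have dm x : delta y x != 0 -> (qsize x <= m)%N.
    by rewrite /delta; have [->|] := eqVneq x y; rewrite ?leqnSn ?eqxx.
  have Pm x : P (delta y) x != 0 -> (qsize x <= m)%N.
    apply: contraNT; rewrite -ltnNge => mx; rewrite P_delta.
    have -> : delta y x = 0 by apply/eqP; move: mx; apply: contraTT => /dm; rewrite -leqNgt.
    have -> : chain_rate arr step x y = 0.
      by apply/eqP; move: mx; apply: contraTT => /rm; rewrite -leqNgt.
    by rewrite !(mulr0, subr0, addr0).
  rewrite (@esum_finType R _ _ (@box_state m))//; first last.
  - move=> x; rewrite eqe mulf_eq0 negb_or => /andP[_ /rm]; exact: box_stateP.
  - by move=> x; rewrite lee_fin mulr_ge0.
  - exact: box_state_inj.
  rewrite sumEFin; congr EFin.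
  have l1 := limA _ (index_enum _) (fun b => P (delta y) (box_state b)) (@box_state m).
  rewrite -expand// in l1.
  have l2 : (fun k => A k (P (delta y)) - A k (delta y)) @ U --> (0 : R).
    apply: cvg_trans (cvg_app _ oU) _.
    apply: (@squeeze_cvgr _ _ _ _ (fun k => - k.+1%:R^-1) (fun k => k.+1%:R^-1)).
    - apply: nearW => k; rewrite AP -mulrN1 -[X in _ && (_ <= X)]mulr1.
      have i0 : 0 <= iter k.+1 P (delta y) q0.
        have := @iterP_le k.+1 (fun=> 0) (delta y); rewrite iterP1; exact.
      have i1 : iter k.+1 P (delta y) q0 <= 1.
        have := @iterP_le k.+1 (delta y) (fun=> 1); rewrite iterP1; apply=> //.
        by move=> q _; rewrite /delta; case: eqP.
      rewrite !(ler_pM2l (k0 k)).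
      have : 0 <= delta y q0 <= 1 by rewrite /delta; case: eqP; rewrite ?lexx ler01.
      by move=> /andP[d0 d1]; apply/andP; split; lra.
    - by rewrite -oppr0; apply: cvgN; exact: cvg_harmonic.
    - exact: cvg_harmonic.
  have l3 := cvgD l2 (pP y); rewrite add0r in l3.
  have e : p y = \sum_b P (delta y) (box_state b) * p (box_state (m := m) b).
    suff l4 : (fun k => A k (P (delta y))) @ U --> p y.
      exact: (cvg_unique _ l4 l1).
    rewrite (_ : (fun k => A k (P (delta y))) =
      (fun k => A k (P (delta y)) - A k (delta y)) \+ (fun k => A k (delta y))).
      exact: l3.
    by apply/funext => k /=; rewrite subrK.
  have py : \sum_b delta y (box_state b) * p (box_state (m := m) b) = p y.
    have [b0 yb] := @box_stateP m y (leqnSn _).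
    rewrite (bigD1 b0)//= /delta -yb eqxx mul1r big1 ?addr0// => b bb0.
    rewrite yb; case: eqP => [/box_state_inj/eqP|]; last by rewrite mul0r.
    by rewrite (negPf bb0).
  have pt : \sum_b total_rate arr (box_state b) * delta y (box_state b) *
      p (box_state (m := m) b) = total_rate arr y * p y.
    rewrite -py mulr_sumr; apply: eq_bigr => b _; rewrite mulrA /delta.
    by case: eqP => [->//|_]; rewrite !(mulr0, mul0r).
  move: e; under eq_bigr do rewrite P_delta mulrDl -mulrA mulrBl.
  rewrite big_split/= py -[LHS]addr0 => /addrI/esym/eqP.
  rewrite -mulr_sumr sumrB pt mulf_eq0 invr_eq0 gt_eqF//= subr_eq0 => /eqP e.
  by rewrite mulrC -e; apply: eq_bigr => b _; rewrite mulrC.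
exists p; split => //.
- apply/eqP; rewrite eq_le; apply/andP; split.
    apply: esum_le_seq => s us; rewrite sumEFin lee_fin.
    have := limA _ s (fun=> 1) id.
    under eq_bigr do rewrite mul1r.
    move=> /cvgr_to_le; apply; apply: filterE => k; rewrite -[leRHS](A1 k).
    apply: A_le => q _; under eq_bigr do rewrite mul1r.
    by rewrite sum_delta_seq// lern1 leq_b1.
  set M := (B + L * f q0) / c.
  (* Markov's inequality: uniformly in [k], the averaged laws put mass at most [M / (m + 1)] outside
     the box. *)
  have lb m : ((1 - m.+1%:R^-1 * M)%:E <= \esum_(x in setT) (p x)%:E)%E.
    pose s := [seq box_state (m := m) b | b <- enum {ffun agent n -> 'I_m.+1}].
    have us : uniq s by rewrite map_inj_uniq ?enum_uniq//; exact: box_state_inj.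
    apply: le_trans (le_esum_seq _ us); rewrite sumEFin lee_fin.
    have := limA _ s (fun=> 1) id.
    under eq_bigr do rewrite mul1r.
    move=> /cvgr_to_ge; apply; apply: filterE => k.
    apply: (@le_trans _ _ (A k (fun q => 1 + (- m.+1%:R^-1) * (qsize q)%:R))).
      by rewrite AD A1 mulNr lerD2l lerN2 ler_wpM2l// size_bound.
    apply: A_le => q _; under eq_bigr do rewrite mul1r.
    rewrite sum_delta_seq//; have [qs|qs] := boolP (q \in s).
      by rewrite mulNr gerBl mulr_ge0// invr_ge0.
    rewrite mulNr subr_le0 mulrC ler_pdivlMr// mul1r ler_nat ltnNge.
    apply: contra qs => /box_stateP[b ->]; apply/map_f; exact: mem_enum.
  apply/lee_addgt0Pr => e e0.
  have M0 : 0 <= M.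
    by apply: le_trans (size_bound 0); rewrite -(A1 0 0); apply: A_le => q _.
  have := lb (Num.truncn (M / e)).
  have : (Num.truncn (M / e)).+1%:R^-1 * M <= e.
    rewrite mulrC ler_pdivrMr// mulrC -ler_pdivrMr//.
    by apply/ltW; rewrite truncnS_gt.
  move: (_ * M) => z ze; rewrite EFinB leeBlDr//; move/le_trans; apply.
  by rewrite leeD2l// lee_fin.
- move=> x nSx; have /cvg_unique := pP x; apply => //.
  have -> : (fun k => A k (delta x)) = fun=> 0; last exact: cvg_cst.
  apply/funext => k; rewrite -[RHS](A1 k).
  have d0 q : S q -> delta x q = 0 by rewrite /delta; case: eqP => // ->.
  by apply/eqP; rewrite eq_le !A_le// => q Sq; rewrite d0.
- move=> y; rewrite exit_rateE// -EFinM.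
  have := bal y; rewrite (esumD1 y); last first.
    by move=> x; rewrite lee_fin mulr_ge0// chain_rate_ge0.
  move=> e; rewrite mulrBr EFinB -e.
  by rewrite addeAC subee// add0e.
Qed.

End Existence.

(** * Positive recurrence *)

Section Recurrence.
Context {R : realType} {T : countType}.
Implicit Types (r : T -> T -> R) (x y z : T) (C : set T) (p : T -> R).

Lemma reaches_refl r x : reaches r x x.
Proof. by exists [::]. Qed.

Lemma reaches_trans r y x z : reaches r x y -> reaches r y z -> reaches r x z.
Proof.
move=> [s [xs <-]] [t [yt <-]]; exists (s ++ t).
by rewrite cat_path xs yt last_cat.
Qed.

Lemma reaches1 r x y : jump_rel r x y -> reaches r x y.
Proof. by move=> xy; exists [:: y]; rewrite /= xy. Qed.

Lemma reaches_ind r x (Q : T -> Prop) :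
  Q x -> (forall y z, reaches r x y -> Q y -> jump_rel r y z -> Q z) ->
  forall y, reaches r x y -> Q y.
Proof.
move=> Qx Qstep y [s [xs <-]]; elim/last_ind: s xs => //= s z IH.
rewrite rcons_path last_rcons => /andP[xs sz].
by apply: Qstep (IH xs) sz; exists s.
Qed.

Lemma taboo_prob_ge0 r x k y :
  (forall x y, 0 <= r x y) -> (0 <= taboo_prob r x k y)%E.
Proof.
move=> r0; elim: k y => [|k IH] y /=; first by rewrite lee_fin.
case: ifP => // _; apply: esum_ge0 => z _; rewrite mule_ge0// lee_fin /jump_prob.
by case: ifP => // _; rewrite divr_ge0// fine_ge0// esum_ge0// => u _; rewrite lee_fin.
Qed.

Context (r : T -> T -> R) (C : set T) (p e : T -> R).
Hypothesis r0 : forall x y, 0 <= r x y.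
Hypothesis eE : forall x, exit_rate r x = (e x)%:E.
Hypothesis e0 : forall x, 0 < e x.
Hypothesis st : stationary_law r C p.

(* The flow [p * e] is an invariant measure of the jump chain, hence dominates
   the minimal one, which counts the visits during an excursion from x. *)
Lemma taboo_prob_flow x K y :
  ((p x * e x)%:E * \sum_(k < K) taboo_prob r x k y <= (p y * e y)%:E)%E.
Proof.
have [p0 _ _ bal] := st.
have m0 z : 0 <= p z * e z by rewrite mulr_ge0// ltW.
elim: K y => [|K IH] y; first by rewrite big_ord0 mule0 lee_fin.
(* At [y = x] only time 0 counts, later visits being taboo. Elsewhere the term at time 0 vanishes
   and the others arise by one jump from the sum up to [K]. *)
rewrite big_ord_recl/=; case: eqP => [->|/eqP yx].
  by rewrite big1_eq adde0 mule1.
rewrite add0e -esum_sum; last first.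
  move=> z k _ _; rewrite mule_ge0 ?taboo_prob_ge0// lee_fin /jump_prob.
  by case: ifP => // _; rewrite divr_ge0// eE/= ltW.
have jp0 z : 0 <= jump_prob r z y.
  by rewrite /jump_prob; case: ifP => // _; rewrite divr_ge0// eE/= ltW.
rewrite -esumZ//; last first.
  move=> z; apply: sume_ge0 => k _; apply: mule_ge0; rewrite ?lee_fin//.
  exact: taboo_prob_ge0.
have := bal y; rewrite eE -EFinM => <-.
rewrite [leRHS]esum_mkcond; apply: le_esum => z _.
rewrite -ge0_sume_distrl; last by move=> k _; exact: taboo_prob_ge0.
rewrite muleA; apply: (@le_trans _ _ ((p z * e z)%:E * (jump_prob r z y)%:E)%E).
  by rewrite lee_wpmul2r// lee_fin.
have [->|zy] := eqVneq z y.
  by rewrite /jump_prob eqxx mule0 memNset//= eqxx.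
rewrite mem_set//= /jump_prob eq_sym (negPf zy) eE/= -EFinM lee_fin.
by rewrite mulrACA [e z * _]mulrC mulrA mulfVK ?gt_eqF// mulr1.
Qed.

(** Summing [taboo_prob_flow] over states with weights [1 / e y] bounds the mean return time by
    [1 / (p x * e x)]. *)
Lemma stationary_law_recurrent x : 0 < p x -> positive_recurrent r x.
Proof.
move=> px; right; have [p0 p1 _ _] := st.
have m0 : 0 < p x * e x by rewrite mulr_gt0.
have inv_e y : ((exit_rate r y)^-1 = ((e y)^-1)%:E)%E by rewrite eE inver gt_eqF.
have i0 y : (0 <= (exit_rate r y)^-1)%E by rewrite inv_e lee_fin invr_ge0 ltW.
have t0 k y := taboo_prob_ge0 x k y r0.
rewrite /mean_return_time.
have -> : [set: nat * T] = setT `*`` (fun=> setT) by apply/seteqP; split.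
rewrite -(@esum_esum _ _ _ _ _
  (fun k y => taboo_prob r x k y * (exit_rate r y)^-1)%E); last first.
  by move=> k y _ _; rewrite mule_ge0.
rewrite esum_swap; last by move=> k y; rewrite mule_ge0.
apply: (@le_lt_trans _ _ (\esum_(y in setT) ((p x * e x)^-1%:E * (p y)%:E))%E).
  apply: le_esum => y _; rewrite -nneseries_esumT; last by move=> k; rewrite mule_ge0.
  apply: lime_le; first by apply: is_cvg_nneseries => k _ _; rewrite mule_ge0.
  apply: nearW => K; rewrite big_mkord -ge0_sume_distrl// inv_e.
  rewrite lee_pdivlMl//; apply: le_trans (_ : _ <= (p y * e y)%:E * (e y)^-1%:E)%E _.
    by rewrite muleA lee_wpmul2r ?taboo_prob_flow// lee_fin invr_ge0 ltW.
  by rewrite -EFinM mulfK ?gt_eqF.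
rewrite esumZ ?p1 ?mule1 ?ltry ?invr_ge0 ?(ltW m0)//.
Qed.

(** By the balance equation at [z], an inflow [p y * r y z > 0] excludes [p z = 0]; this propagates
    along paths. *)
Lemma stationary_law_gt0 x y : 0 < p x -> reaches r x y -> 0 < p y.
Proof.
have [p0 _ _ bal] := st.
move=> px; move: y; apply: reaches_ind => // y z _ py /andP[zy ryz].
rewrite lt_neqAle p0 andbT; apply: contraTneq isT => pz.
have : ((p y * r y z)%:E <= 0)%E.
  rewrite [leRHS](_ : _ = (p z)%:E * exit_rate r z)%E; last by rewrite -pz mul0e.
  rewrite -bal esum_mkcond; have := @le_esum_seq R _
    (fun u => if u \in [set u | u != z] then (p u * r u z)%:E else 0%E) [:: y].
  rewrite big_seq1 mem_set/=; last by rewrite eq_sym.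
  exact.
by rewrite lee_fin leNgt mulr_gt0.
Qed.

Lemma stationary_law_ex_gt0 : exists2 x, C x & 0 < p x.
Proof.
have [p0 p1 pC _] := st; apply: contrapT => np.
have : (\esum_(x in setT) (p x)%:E = 0)%E.
  apply: esum1 => x _; congr EFin; apply/eqP; rewrite -[_ == _]negbK.
  apply/negP => px; apply: np.
  have [Cx|/pC px0] := pselect (C x); last by rewrite px0 eqxx in px.
  by exists x => //; rewrite lt_neqAle eq_sym px p0.
by rewrite p1 => /eqP; rewrite eqe oner_eq0.
Qed.

End Recurrence.

(** * Lower bound on the total queue length *)

Section TailBound.
Context {R : realType} {n : nat}.
Implicit Types (p u : state n -> R).

(** A finite set of states nearly attains the supremum defining [mean p u]. This plays the part of
    dominated convergence. *)
Lemma mean_tail p u (e : R) :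
  (forall q, 0 <= p q) -> (forall q, 0 <= u q) -> (mean p u < +oo)%E -> 0 < e ->
  exists s : seq (state n), (mean p (fun q => (q \notin s)%:R * u q)%R <= e%:E)%E.
Proof.
move=> p0 u0 mu e0.
have pu0 q : (0 <= (p q * u q)%:E)%E by rewrite lee_fin mulr_ge0.
have mfin : mean p u \is a fin_num by rewrite ge0_fin_numE// esum_ge0.
have [_ [X [finX _] <-] Xm] := ub_ereal_sup_adherent e0 mfin.
exists (fset_set X); rewrite fsbig_finite//= in Xm.
pose v q := ((q \in fset_set X)%:R * u q)%R.
have mv : (mean p u = mean p v +
    mean p (fun q => (q \notin fset_set X)%:R * u q)%R)%E.
  rewrite /mean -esumD; do ?by move=> q _; rewrite lee_fin !mulr_ge0.
  apply: eq_esum => q _; rewrite -EFinD /v; congr EFin.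
  by case: (q \in _); rewrite /= ?mul0r ?mul1r ?mulr0 ?addr0 ?add0r.
have Xv : (\sum_(q <- fset_set X) (p q * u q)%:E <= mean p v)%E.
  apply: le_trans (le_esum_seq _ (fset_uniq (fset_set X))).
  rewrite big_seq [leRHS]big_seq; apply: lee_sum => q qX.
  by rewrite /v qX mul1r.
have : (mean p u - e%:E <= mean p v)%E by apply/ltW/(lt_le_trans Xm).
rewrite leeBlDr// {1}mv leeD2lE//.
move: mfin; rewrite mv fin_numD => /andP[]//.
Qed.
End TailBound.

(** * Drift of the squared imbalance *)

Section Imbalance.
Context {R : realType} {n : nat}.
Implicit Types (q : state n) (a : agent n).

Definition side a : R := if a is inl _ then 1 else -1.

Definition imbalance q : R := \sum_a side a * (q a)%:R.

Lemma normr_side a : `|side a| = 1.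
Proof. by case: a => i /=; rewrite ?normrN normr1. Qed.

Lemma normr_imbalance q : `|imbalance q| <= (qsize q)%:R.
Proof.
rewrite /imbalance /qsize natr_sum; apply: le_trans (ler_norm_sum _ _ _) _.
by apply: ler_sum => a _; rewrite normrM normr_side mul1r ger0_norm.
Qed.

Lemma drift_sqr_imbalance (arr : state n -> agent n -> R) step q :
  (forall a, imbalance (step q a) = imbalance q + side a) ->
  drift arr step (fun q => imbalance q ^+ 2) q =
  total_rate arr q + 2 * imbalance q * \sum_a side a * arr q a.
Proof.
move=> Dstep; rewrite /drift /total_rate mulr_sumr -big_split.
apply: eq_bigr => a _ /=; rewrite Dstep.
have : side a ^+ 2 = 1 by rewrite -real_normK ?num_real// normr_side expr1n.
by move: (side a) => s s2; ring: s2.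
Qed.

(* The drift of [D^2] need not average to 0 when [D^2] is not integrable: it is
   tested through the bounded function [(K^2 - D^2)^+], and the error, which is
   supported by [|D| + 1 >= K], vanishes as K grows because T is integrable. *)
Lemma mean_size_ge arr (step : state n -> agent n -> state n) C p (L k r : R) :
  (forall q a, 0 <= arr q a) -> (forall q, total_rate arr q <= L) -> 0 < k ->
  stationary_law (chain_rate arr step) C p ->
  (forall q a, C q -> imbalance (step q a) = imbalance q + side a) ->
  (forall q, C q ->
     r - k * (qsize q)%:R <= drift arr step (fun q => imbalance q ^+ 2) q) ->
  (r%:E <= k%:E * mean p (fun q => (qsize q)%:R))%E.
Proof.
move=> arr0 arrL k0 st Dstep dr; have [p0 p1 pC _] := st.
set m := mean p _.
have m0 : (0 <= m)%E by apply: esum_ge0 => q _; rewrite lee_fin mulr_ge0.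
have [moo|mfin] := eqVneq m +oo%E.
  by rewrite moo gt0_muley ?lte_fin// leey.
have mlt : (m < +oo)%E by rewrite ltey.
(* A negative [r] is trivial; the comparison below takes the constant [r] as its nonnegative [g]. *)
have [r0|r0] := ltP r 0.
  by apply: (@le_trans _ _ 0%E); [rewrite lee_fin ltW|rewrite mule_ge0// lee_fin ltW].
have L0 : 0 <= L by apply: le_trans (arrL [ffun=> 0%N]); apply: sumr_ge0.
(* An arrival changes D^2 by at most 2T + 1, and arrivals occur at rate at most [L]: [u] bounds the
   error due to truncation. *)
pose u q : R := L * (2 * (qsize q)%:R + 1).
have u0 q : 0 <= u q by rewrite mulr_ge0// addr_ge0// mulr_ge0.
have muE : mean p u = (L%:E * (2%:E * m + 1))%E.
  rewrite /m /mean -p1 -esumZ//; last by move=> q; rewrite lee_fin mulr_ge0.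
  rewrite -esumD; [|by move=> q _; rewrite lee_fin !mulr_ge0
                   |by move=> q _; rewrite lee_fin].
  rewrite -esumZ//; last by move=> q; rewrite lee_fin addr_ge0// !mulr_ge0.
  apply: eq_esum => q _; rewrite -[X in (_ * (X + _))%E]EFinM -EFinD -EFinM /u.
  by congr EFin; ring.
have mult : (mean p u < +oo)%E.
  by rewrite muE -(fineK (x := m)) ?ge0_fin_numE// -[X in (_ * (X + _))%E]EFinM -EFinD -EFinM ltry.
apply/lee_addgt0Pr => e e0.
have [s sP] := mean_tail p0 u0 mult e0.
(* On [s] this gives |D| + 1 < [K], so the truncation is inactive both before and after an
   arrival. *)
pose K : R := 2 + \sum_(q <- s) (qsize q)%:R.
have sK q : q \in s -> `|imbalance q| + 1 < K.
  move=> qs; apply: (@le_lt_trans _ _ (1 + (qsize q)%:R)).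
    by rewrite addrC lerD2l normr_imbalance.
  apply: (@lt_le_trans _ _ (2 + (qsize q)%:R)); first by rewrite ltrD2r ltr1n.
  by rewrite lerD2l (big_rem q)//= lerDl sumr_ge0.
pose f q := Num.max 0 (K ^+ 2 - imbalance q ^+ 2).
pose h q := k * (qsize q)%:R + (q \notin s)%:R * u q.
have h0 q : 0 <= h q by rewrite addr_ge0// mulr_ge0// ltW.
have f0 q : 0 <= f q by rewrite le_max lexx.
have fh q : C q -> drift arr step f q <= h q - r.
  move=> Cq; have := dr q Cq; rewrite /drift => {}dr.
  have : drift arr step f q <= - (\sum_a arr q a *
      (imbalance (step q a) ^+ 2 - imbalance q ^+ 2)) + (q \notin s)%:R * u q.
    apply: (@le_trans _ _ (\sum_a arr q a * (- (imbalance (step q a) ^+ 2 -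
        imbalance q ^+ 2) + (q \notin s)%:R * (2 * (qsize q)%:R + 1)))).
      apply: ler_sum => a _; rewrite ler_wpM2l// /f Dstep//.
      have := normr_imbalance q; have := normr_side a; have := sK q.
      move: (imbalance q) (side a) ((qsize q)%:R : R) => D b T qK b1 DT.
      have b2 : b ^+ 2 = 1 by rewrite -real_normK ?num_real// b1 expr1n.
      have Db : `|D * b| <= T by rewrite normrM b1 mulr1.
      have Dbl : - T <= D * b by move: Db; rewrite ler_norml => /andP[].
      have Dbu : D * b <= T by move: Db; rewrite ler_norml => /andP[].
      have -> : (D + b) ^+ 2 = D ^+ 2 + 2 * (D * b) + 1 by rewrite sqrrD b2; ring.
      case: (boolP (q \in s)) => qs /=; last first.
        rewrite mul1r; case: (lerP 0 (K ^+ 2 - (D ^+ 2 + 2 * (D * b) + 1)));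
        case: (lerP 0 (K ^+ 2 - D ^+ 2)); lra.
      have {}qK := qK qs; rewrite mul0r addr0.
      have D0 : `|D| ^+ 2 = D ^+ 2 by rewrite real_normK ?num_real.
      have Dbn : D * b <= `|D| by rewrite -[leRHS]mulr1 -b1 -normrM ler_norm.
      have Dn : 0 <= `|D| by [].
      have -> : Num.max 0 (K ^+ 2 - (D ^+ 2 + 2 * (D * b) + 1)) =
          K ^+ 2 - (D ^+ 2 + 2 * (D * b) + 1).
        by apply/max_idPr; rewrite -D0; nra.
      have -> : Num.max 0 (K ^+ 2 - D ^+ 2) = K ^+ 2 - D ^+ 2.
        by apply/max_idPr; rewrite -D0; nra.
      lra.
    under eq_bigr do rewrite mulrDr mulrN.
    rewrite big_split/= sumrN lerD2l -mulr_suml /u mulrCA ler_wpM2l// ler_wpM2r//.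
    exact: arrL.
  by rewrite /drift /h; lra.
have := mean_comparison arr0 arrL f0 (fun=> r0) h0 st fh.
have -> : mean p (fun=> r) = r%:E.
  rewrite /mean -[RHS]mule1 -p1 -esumZ//.
  by apply: eq_esum => q _; rewrite mulrC EFinM.
move=> /le_trans; apply.
have -> : mean p h = (k%:E * m + mean p (fun q => (q \notin s)%:R * u q)%R)%E.
  rewrite /m /mean -esumZ ?(ltW k0)//; last by move=> q; rewrite lee_fin mulr_ge0.
  rewrite -esumD.
  - by apply: eq_esum => q _; rewrite -EFinM -EFinD; congr EFin; rewrite /h; ring.
  - by move=> q _; rewrite -EFinM lee_fin mulr_ge0// ?mulr_ge0// ltW.
  - by move=> q _; rewrite lee_fin !mulr_ge0.
by rewrite leeD2l.
Qed.

End Imbalance.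

(** * Resource pooling and max-weight matching *)

Section PoolingGap.
Context {R : realType} {n : nat}.

(** Layer-cake formula with a common bound [M], so that all queues are summed over the same
    layers. *)
Lemma nat_layers (M k : nat) :
  (k <= M)%N -> k%:R = \sum_(t < M) (t < k)%N%:R :> R.
Proof.
move=> kM; rewrite -natr_sum; congr _%:R.
rewrite -(big_mkord xpredT (fun t => (t < k)%N : nat)) (big_cat_nat (leq0n k) kM)//=.
rewrite big_nat (eq_bigr (fun=> 1%N)); last by move=> t /andP[_ ->].
rewrite -big_nat sum_nat_const_nat subn0 muln1 big_nat big1 ?addn0// => t /andP[kt _].
by rewrite ltnNge kt.
Qed.

(* Summation over the layers [{j | t < x j}], t = 0, 1, ...; the layers with
   [x j0 <= t < x j1] are proper and nonempty. *)
Lemma pooling_gap (e : 'I_n -> 'I_n -> bool) (w v : 'I_n -> R) (d : R)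
    (x : 'I_n -> nat) (j0 j1 : 'I_n) :
  (forall i, exists j, e j i) -> (forall i, 0 <= v i) ->
  \sum_j w j = \sum_i v i -> 0 <= d ->
  (forall J : {set 'I_n}, J != finset.set0 -> J \proper finset.setT ->
     \sum_(j in J) w j + d <= \sum_(i | [exists j in J, e j i]) v i) ->
  d * ((x j1)%:R - (x j0)%:R) <=
  \sum_i v i * (\max_(j | e j i) x j)%:R - \sum_j w j * (x j)%:R.
Proof.
move=> eP v0 wv d0 gap.
pose M := \max_j x j.
have xM j : (x j <= M)%N by exact: (leq_bigmax j).
have mM i : (\max_(j | e j i) x j <= M)%N by apply/bigmax_leqP => j _.
pose J (t : nat) : {set 'I_n} := [set j | (t < x j)%N]%SET.
(* The layers of the neighbourhood maxima are the neighbourhoods of the layers, the sets to which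
   [gap] applies. *)
have mJ i t : (t < \max_(j | e j i) x j)%N = [exists j in J t, e j i].
  rewrite ltnNge; apply/idP/existsP => [|[j]].
    move=> /bigmax_leqP h; apply: contrapT => nj; apply: h => j eji.
    rewrite leqNgt; apply/negP => tj; apply: nj; exists j.
    by rewrite inE tj.
  rewrite inE => /andP[tj eji]; apply/negP => /bigmax_leqP/(_ j eji).
  by rewrite leqNgt tj.
have sw : \sum_j w j * (x j)%:R = \sum_(t < M) \sum_(j in J t) w j.
  rewrite (eq_bigr (fun j => \sum_(t < M) (if j \in J t then w j else 0))).
    by rewrite exchange_big; apply: eq_bigr => t _; rewrite -big_mkcond.
  move=> j _; rewrite (nat_layers (xM j)) mulr_sumr; apply: eq_bigr => t _.
  by rewrite inE; case: ifP => _; rewrite ?mulr1 ?mulr0.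
have sv : \sum_i v i * (\max_(j | e j i) x j)%:R =
    \sum_(t < M) \sum_(i | [exists j in J t, e j i]) v i.
  rewrite (eq_bigr (fun i => \sum_(t < M)
      (if [exists j in J t, e j i] then v i else 0))).
    by rewrite exchange_big; apply: eq_bigr => t _; rewrite -big_mkcond.
  move=> i _; rewrite (nat_layers (mM i)) mulr_sumr; apply: eq_bigr => t _.
  by rewrite mJ; case: ifP => _; rewrite ?mulr1 ?mulr0.
rewrite sw sv (nat_layers (xM j1)) (nat_layers (xM j0)) -!sumrB mulr_sumr.
(* An empty layer gives 0 on the left; the full layer gives 0 on both sides because the totals
   agree; otherwise [gap] applies, the difference of indicators being at most 1. *)
apply: ler_sum => t _; have [J0|J0] := eqVneq (J t) finset.set0.
  have nJ j : (t < x j)%N = false by have := finset.in_set0 j; rewrite -J0 inE.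
  rewrite !nJ subrr mulr0 J0 big_set0 subr0 sumr_ge0//.
have [JT|JT] := eqVneq (J t) finset.setT.
  have aJ j : (t < x j)%N by have := finset.in_setT j; rewrite -JT inE.
  rewrite !aJ subrr mulr0 JT subr_ge0.
  rewrite (eq_bigl xpredT); last by move=> j; rewrite finset.in_setT.
  rewrite wv le_eqVlt; apply/orP; left; apply/eqP/eq_bigl => i /=.
  by apply/esym/existsP; have [j eji] := eP i; exists j; rewrite finset.in_setT.
have JP : J t \proper finset.setT by rewrite finset.properT.
have := gap _ J0 JP.
have : d * ((t < x j1)%N%:R - (t < x j0)%N%:R) <= d.
  by rewrite ler_piMr//; case: (t < x j1)%N; case: (t < x j0)%N => /=; lra.
lra.
Qed.

Lemma finite_gap (I : finType) (Q : pred I) (h : I -> R) :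
  (forall i, Q i -> 0 < h i) -> exists2 d, 0 < d & forall i, Q i -> d <= h i.
Proof.
move=> hp; exists (\big[Num.min/1]_(i | Q i) h i).
  by apply: lt_bigmin.
by move=> i Qi; apply: bigmin_le_cond.
Qed.

(** Only finitely many subsets occur, so the strict inequalities share a positive slack. *)
Lemma resource_pooling_gap (E : {set 'I_n * 'I_n}) (lam mu : 'I_n -> R) :
  resource_pooling E lam mu -> exists2 d, 0 < d &
    (forall J : {set 'I_n}, J != finset.set0 -> J \proper finset.setT ->
     \sum_(j in J) lam j + d <= \sum_(i | [exists j in J, (i, j) \in E]) mu i) /\
    (forall I : {set 'I_n}, I != finset.set0 -> I \proper finset.setT ->
     \sum_(i in I) mu i + d <= \sum_(j | [exists i in I, (i, j) \in E]) lam j).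
Proof.
move=> [c s]; pose Q (J : {set 'I_n}) := (J != finset.set0) && (J \proper finset.setT).
have [|d1 d10 dc] := @finite_gap _ Q
  (fun J => \sum_(i | [exists j in J, (i, j) \in E]) mu i - \sum_(j in J) lam j).
  by move=> J /andP[J0 JT]; rewrite subr_gt0 c.
have [|d2 d20 ds] := @finite_gap _ Q
  (fun I => \sum_(j | [exists i in I, (i, j) \in E]) lam j - \sum_(i in I) mu i).
  by move=> J /andP[J0 JT]; rewrite subr_gt0 s.
exists (Num.min d1 d2); first by rewrite lt_min d10.
split=> J J0 JT; rewrite addrC -lerBrDr.
  by apply: le_trans (dc J _); rewrite ?ge_min ?lexx// /Q J0.
by apply: le_trans (ds J _); rewrite ?ge_min ?lexx ?orbT// /Q J0.
Qed.

End PoolingGap.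

(** * Effect of one max-weight move *)

Section MaxWeight.
Context {R : realType} {n : nat}.
Implicit Types (q : state n) (a b : agent n) (E : {set 'I_n * 'I_n}).

Lemma sum_mul_eq (F : agent n -> R) a : \sum_b F b * (b == a)%:R = F a.
Proof.
rewrite (bigD1 a)//= eqxx mulr1 big1 ?addr0// => b /negPf->.
by rewrite mulr0.
Qed.

Lemma add_agentE q a b : (add_agent q a b)%:R = (q b)%:R + (b == a)%:R :> R.
Proof. by rewrite ffunE natrD. Qed.

Lemma remove_agentE q a b :
  (0 < q a)%N -> (remove_agent q a b)%:R = (q b)%:R - (b == a)%:R :> R.
Proof. by move=> qa; rewrite ffunE natrB//; case: eqP => // ->. Qed.

Lemma imbalance_add_agent q a :
  imbalance (add_agent q a) = imbalance q + side a :> R.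
Proof.
rewrite -[side a in RHS](sum_mul_eq (@side R n)) -big_split.
by apply: eq_bigr => b _; rewrite add_agentE mulrDr.
Qed.

Lemma imbalance_remove_agent q a : (0 < q a)%N ->
  imbalance (remove_agent q a) = imbalance q - side a :> R.
Proof.
move=> qa; rewrite -[side a in RHS](sum_mul_eq (@side R n)) -sumrB.
by apply: eq_bigr => b _; rewrite remove_agentE// mulrBr.
Qed.

Lemma side_compatible E a b : compatible E a b -> side b = - side a :> R.
Proof. by case: a b => [j|i] [j'|i'] //= _; rewrite opprK. Qed.

Lemma compatible_sym E a b : compatible E a b = compatible E b a.
Proof. by case: a b => [j|i] [j'|i']. Qed.

(** The invariant of max-weight matching: compatible agents never wait at the same time. *)
Definition complementary E q : Prop :=
  forall a b, compatible E a b -> q a = 0%N \/ q b = 0%N.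

Definition max_compatible E q a : nat := \max_(b | compatible E a b) q b.

Definition sqr_size q : R := \sum_a (q a)%:R ^+ 2.

Lemma max_weight_imbalance E q a q' : max_weight_move E q a q' ->
  imbalance q' = imbalance q + side a :> R.
Proof.
case=> [[b [ab qb _ ->]]|[_ ->]]; last exact: imbalance_add_agent.
by rewrite imbalance_remove_agent// (side_compatible ab) opprK.
Qed.

(** A match only shortens queues, and an arrival joins its queue only when all compatible ones are
    empty. *)
Lemma max_weight_complementary E q a q' :
  complementary E q -> max_weight_move E q a q' -> complementary E q'.
Proof.
move=> qE [[b [_ _ _ ->]]|[a0 ->]] c d cd; rewrite !ffunE.
  by case: (qE c d cd) => ->; [left|right].
have [ca|_] := eqVneq c a.
  right; rewrite -ca in a0; rewrite a0// -ca; case: eqP => // dc.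
  by move: cd; rewrite dc; case: (c).
have [da|_] := eqVneq d a; last by rewrite !addn0; exact: qE.
by left; rewrite a0// -da compatible_sym.
Qed.

Lemma qsize_add_agent q a : qsize (add_agent q a) = (qsize q).+1.
Proof.
rewrite /qsize (bigD1 a)//= [in RHS](bigD1 a)//= ffunE eqxx addn1 addSn.
congr (_ + _).+1; apply: eq_bigr => b /negPf ba.
by rewrite ffunE ba addn0.
Qed.

Lemma qsize_remove_agent q a :
  (0 < q a)%N -> (qsize (remove_agent q a)).+1 = qsize q.
Proof.
move=> qa; rewrite /qsize (bigD1 a)//= [in RHS](bigD1 a)//= ffunE eqxx.
rewrite -addSn subn1 prednK//; congr (_ + _)%N; apply: eq_bigr => b /negPf ba.
by rewrite ffunE ba subn0.
Qed.

Lemma max_weight_size E q a q' :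
  max_weight_move E q a q' -> (qsize q <= (qsize q').+1)%N.
Proof.
case=> [[b [_ qb _ ->]]|[_ ->]]; first by rewrite qsize_remove_agent.
by rewrite qsize_add_agent ltnW// ltnW.
Qed.

(** In a match the longest compatible queue, of length m, changes the sum by 1 - 2m, and [q a = 0]
    by complementarity. When [a] joins, the change is [1 + 2 * q a] and the maximum is 0. One
    formula covers both cases. *)
Lemma max_weight_sqr_size E q a q' :
  complementary E q -> max_weight_move E q a q' ->
  sqr_size q' - sqr_size q = 1 + 2 * ((q a)%:R - (max_compatible E q a)%:R).
Proof.
move=> qE [[b [ab qb bmax ->]]|[a0 ->]].
  have -> : max_compatible E q a = q b.
    apply/eqP; rewrite eqn_leq; apply/andP; split; first exact/bigmax_leqP.
    exact: (leq_bigmax_cond b).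
  have -> : q a = 0%N by case: (qE a b ab) => // b0; rewrite b0 in qb.
  rewrite /sqr_size -sumrB.
  rewrite -(sum_mul_eq (fun b => 1 + 2 * (0%:R - (q b)%:R)) b).
  apply: eq_bigr => c _; rewrite remove_agentE//.
  by case: eqP => _ /=; ring.
have -> : max_compatible E q a = 0%N.
  by apply/eqP; rewrite -leqn0; apply/bigmax_leqP => b /a0 ->.
rewrite /sqr_size -sumrB -(sum_mul_eq (fun a => 1 + 2 * ((q a)%:R - 0%:R)) a).
apply: eq_bigr => c _; rewrite add_agentE//.
by case: eqP => _ /=; ring.
Qed.

End MaxWeight.

(** * Lyapunov function of the two-price policy *)

Section TwoPrice.
Context {R : realType} {n : nat} (E : {set 'I_n * 'I_n}) (lam mu : 'I_n -> R).
Context (eta sigma tau : R).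
Implicit Types (q : state n) (a b : agent n).

Let weight a : R := match a with inl j => lam j | inr i => mu i end.
Let busy q a : R := (tau < (q a)%:R)%R%:R.
Let arr := two_price lam mu eta sigma tau : state n -> agent n -> R.
Let W := \sum_j lam j + \sum_i mu i.

Hypothesis n_gt0 : (0 < n)%N.
Hypothesis balanced : \sum_j lam j = \sum_i mu i.
Hypothesis weight_gt0 : forall a, 0 < weight a.
Hypothesis eta_gt0 : 0 < eta.
Hypothesis sigma_gt0 : 0 < sigma.

Let arrE q a : arr q a = eta * weight a - sigma * busy q a. Proof. by []. Qed.

Let WE : W = \sum_a weight a. Proof. by rewrite big_sumType. Qed.

Let busy01 q a : 0 <= busy q a <= 1.
Proof. by rewrite /busy; case: (_ < _)%R; rewrite /= ?lexx ?ler01. Qed.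

Let W_gt0 : 0 < W.
Proof.
rewrite WE (bigD1 (inl (Ordinal n_gt0)))//=; apply: ltr_pwDl.
  exact: (weight_gt0 (inl _)).
by apply: sumr_ge0 => a _; exact: ltW.
Qed.

(** This is B in the notation of the overview, where [imbalance] is D. *)
Let net_busy q : R := \sum_a side a * busy q a.

Let sum_arr q : total_rate arr q = eta * W - sigma * \sum_a busy q a.
Proof. by rewrite WE !mulr_sumr -sumrB. Qed.

Lemma total_rate_two_price_le q : total_rate arr q <= eta * W.
Proof.
rewrite sum_arr gerBl mulr_ge0 ?(ltW sigma_gt0)// sumr_ge0// => a _.
Qed.

(** The fluid rates cancel because both sides have the same total. *)
Let side_arr q : \sum_a side a * arr q a = - sigma * net_busy q.
Proof.
have sw : \sum_a side a * weight a = 0.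
  rewrite big_sumType /= -[RHS](subrr (\sum_i mu i)) -{1}balanced -sumrN.
  by congr (_ + _); apply: eq_bigr => i _; rewrite ?mul1r ?mulN1r.
transitivity (eta * \sum_a side a * weight a - sigma * net_busy q); last first.
  by rewrite sw mulr0 add0r mulNr.
rewrite !mulr_sumr -sumrB; apply: eq_bigr => a _; rewrite arrE; ring.
Qed.

Let net_busyE q :
  net_busy q = \sum_j busy q (inl j) - \sum_i busy q (inr i).
Proof.
rewrite /net_busy big_sumType /= -sumrN.
by congr (_ + _); apply: eq_bigr => i _; rewrite ?mul1r ?mulN1r.
Qed.

Let sum_busy (s : 'I_n -> agent n) q : 0 <= \sum_i busy q (s i) <= n%:R.
Proof.
apply/andP; split.
  by apply: sumr_ge0 => i _; have /andP[] := busy01 q (s i).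
rewrite -[X in _ <= X%:R]card_ord -sum1_card natr_sum; apply: ler_sum => i _.
by have /andP[] := busy01 q (s i).
Qed.

Let norm_net_busy q : `|net_busy q| <= n%:R.
Proof.
rewrite net_busyE ler_norml.
have /andP[? ?] := sum_busy inl q; have /andP[? ?] := sum_busy inr q.
by apply/andP; split; lra.
Qed.

Let norm_imbalance_busy q :
  `|imbalance q * net_busy q| <= n%:R * (qsize q)%:R.
Proof. by rewrite normrM mulrC ler_pM// normr_imbalance. Qed.

Lemma two_price_mean_ge (step : state n -> agent n -> state n) C p :
  (forall q a, 0 <= arr q a) ->
  stationary_law (chain_rate arr step) C p ->
  (forall q a, C q -> imbalance (step q a) = imbalance q + side a :> R) ->
  ((W / (2 * n%:R) - sigma / eta)%:E <= (sigma / eta)%:E * mean p total_queue)%E.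
Proof.
move=> arr0 st Dstep.
have n0 : 0 < n%:R :> R by rewrite ltr0n.
have k0 : 0 < 2 * sigma * n%:R by rewrite !mulr_gt0.
(* At most [2 * n] types are above the threshold, so the total rate is at least
   [eta * W - 2 * sigma * n]; divided by [2 * n * eta], this loss becomes [sigma / eta]. *)
have := @mean_size_ge R n arr step C p (eta * W) (2 * sigma * n%:R)
  (eta * W - 2 * sigma * n%:R) arr0 total_rate_two_price_le k0 st Dstep.
have mE : mean p total_queue = mean p (fun q => (qsize q)%:R).
  by congr mean; apply/funext => q; rewrite total_queueE.
rewrite -mE => h.
have {h} : ((eta * W - 2 * sigma * n%:R)%:E <=
    (2 * sigma * n%:R)%:E * mean p total_queue)%E.
  apply: h => q Cq; rewrite drift_sqr_imbalance => [|a]; last exact: Dstep.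
  rewrite sum_arr side_arr.
  have := norm_imbalance_busy q; rewrite ler_norml => /andP[_].
  rewrite -(ler_pM2l sigma_gt0) => h.
  have : sigma * \sum_a busy q a <= sigma * (2 * n%:R).
    rewrite ler_pM2l// big_sumType/= mulr_natl mulr2n.
    by have /andP[_ ?] := sum_busy inl q; have /andP[_ ?] := sum_busy inr q; rewrite lerD.
  lra.
have c0 : 0 < 2 * n%:R * eta by rewrite !mulr_gt0.
rewrite -[X in (_ <= X)%E -> _]muleC => h.
have -> : sigma / eta = (2 * n%:R * eta)^-1 * (2 * sigma * n%:R).
  by field; rewrite !gt_eqF.
rewrite EFinM -muleA lee_pdivlMl// -EFinM [leRHS]muleC; apply: le_trans h.
rewrite lee_fin le_eqVlt; apply/orP; left; apply/eqP.
by field; rewrite !gt_eqF.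
Qed.

Context (d : R).
Hypothesis tau_ge0 : 0 <= tau.
Hypothesis neighbor : forall a, exists b, compatible E a b.
Hypothesis d_gt0 : 0 < d.
Hypothesis lam_gap : forall J : {set 'I_n},
  J != finset.set0 -> J \proper finset.setT ->
  \sum_(j in J) lam j + d <= \sum_(i | [exists j in J, (i, j) \in E]) mu i.
Hypothesis mu_gap : forall I : {set 'I_n},
  I != finset.set0 -> I \proper finset.setT ->
  \sum_(i in I) mu i + d <= \sum_(j | [exists i in I, (i, j) \in E]) lam j.

(** [lam_excess] involves customer queues only and [mu_excess] server queues only; their sum is H of
    the overview. *)
Let lam_excess q : R := \sum_i mu i * (max_compatible E q (inr i))%:R
  - \sum_j lam j * (q (inl j))%:R.
Let mu_excess q : R := \sum_j lam j * (max_compatible E q (inl j))%:R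
  - \sum_i mu i * (q (inr i))%:R.

Let lam_spread q j0 j1 :
  d * ((q (inl j1))%:R - (q (inl j0))%:R) <= lam_excess q.
Proof.
have := @pooling_gap R n (fun j i => (i, j) \in E) lam mu d (fun j => q (inl j)) j0 j1.
rewrite /lam_excess; have -> : \sum_i mu i * (max_compatible E q (inr i))%:R =
    \sum_i mu i * (\max_(j | (i, j) \in E) q (inl j))%:R.
  apply: eq_bigr => i _; congr (_ * _%:R); rewrite /max_compatible big_sumType/=.
  by rewrite [X in maxn _ X]big_pred0_eq maxn0.
apply => //; last exact: ltW.
- by move=> i; have [[j|//] ij] := neighbor (inr i); exists j.
- by move=> i; apply/ltW/(weight_gt0 (inr i)).
Qed.

Let mu_spread q i0 i1 :
  d * ((q (inr i1))%:R - (q (inr i0))%:R) <= mu_excess q.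
Proof.
have := @pooling_gap R n (fun i j => (i, j) \in E) mu lam d (fun i => q (inr i)) i0 i1.
rewrite /mu_excess; have -> : \sum_j lam j * (max_compatible E q (inl j))%:R =
    \sum_j lam j * (\max_(i | (i, j) \in E) q (inr i))%:R.
  apply: eq_bigr => i _; congr (_ * _%:R); rewrite /max_compatible big_sumType/=.
  by rewrite [X in maxn X _]big_pred0_eq max0n.
apply => //; last exact: ltW.
- by move=> j; have [[//|i] ij] := neighbor (inl j); exists i.
- by move=> j; apply/ltW/(weight_gt0 (inl j)).
Qed.

Let sum_spread (x : 'I_n -> nat) (i0 : 'I_n) (h : R) :
  (forall i, d * ((x i)%:R - (x i0)%:R) <= h) -> (x i0)%:R <= tau ->
  \sum_i (x i)%:R <= n%:R * (tau + h / d).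
Proof.
move=> xh x0; rewrite -[X in X%:R * _]card_ord -sum1_card natr_sum mulr_suml.
apply: ler_sum => i _; rewrite mul1r -lerBlDl ler_pdivlMr// mulrC.
by apply: le_trans (xh i); rewrite ler_pM2l// lerD2l lerN2.
Qed.

Let qsizeE q : (qsize q)%:R = \sum_j (q (inl j))%:R + \sum_i (q (inr i))%:R :> R.
Proof. by rewrite -total_queueE. Qed.

Let imbalanceE q :
  imbalance q = \sum_j (q (inl j))%:R - \sum_i (q (inr i))%:R :> R.
Proof.
rewrite /imbalance big_sumType /= -sumrN.
by congr (_ + _); apply: eq_bigr => i _; rewrite ?mul1r ?mulN1r.
Qed.

(* State space collapse: up to O(tau + excess), either all customer queues are
   above the threshold and no server waits, or conversely, and then
   [imbalance * net_busy] is n times the total queue length. *)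
Let collapse q : complementary E q ->
  n%:R * (qsize q)%:R - imbalance q * net_busy q <=
  2 * n%:R ^+ 2 * (2 * tau + (lam_excess q + mu_excess q) / d).
Proof.
move=> qE; have i0 := Ordinal n_gt0.
have n0 : 0 < n%:R :> R by rewrite ltr0n.
have le0 : 0 <= lam_excess q by have := lam_spread q i0 i0; rewrite subrr mulr0.
have me0 : 0 <= mu_excess q by have := mu_spread q i0 i0; rewrite subrr mulr0.
have rhs0 : 0 <= 2 * n%:R ^+ 2 * (2 * tau + (lam_excess q + mu_excess q) / d).
  rewrite mulr_ge0//.
  apply: addr_ge0; first exact: mulr_ge0.
  by apply: divr_ge0; [exact: addr_ge0|exact: ltW].
(* If every queue of one side is above the threshold, each type of the other side has a nonempty
   compatible queue, hence is empty by complementarity. *)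
have full (s s' : 'I_n -> agent n) :
    (forall i, tau < (q (s i))%:R) ->
    (forall i, exists j, compatible E (s' i) (s j)) ->
    [/\ \sum_i busy q (s i) = n%:R, \sum_i busy q (s' i) = 0 &
        \sum_i (q (s' i))%:R = 0 :> R].
  move=> sq ss'.
  have q0 i : q (s' i) = 0%N.
    have [j ij] := ss' i; have [//|qj] := qE _ _ ij.
    by have := sq j; rewrite qj ltNge tau_ge0.
  split; last by rewrite big1// => i _; rewrite q0.
    rewrite -[RHS](congr1 (fun k => k%:R) (card_ord n)) -sum1_card natr_sum.
    by apply: eq_bigr => i _; rewrite /busy sq.
  by rewrite big1// => i _; rewrite /busy q0 ltNge tau_ge0.
have [allc|] := pselect (forall j, tau < (q (inl j))%:R).
  have [|b1 b2 q2] := full inl inr allc.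
    by move=> i; have [[j|//] ij] := neighbor (inr i); exists j.
  by rewrite net_busyE imbalanceE qsizeE b1 b2 q2 subr0 addr0 subr0 mulrC subrr.
have [alls|] := pselect (forall i, tau < (q (inr i))%:R).
  have [|b1 b2 q2] := full inr inl alls.
    by move=> i; have [[//|j] ij] := neighbor (inl i); exists j.
  move=> _; rewrite net_busyE imbalanceE qsizeE b1 b2 q2 !sub0r add0r.
  by rewrite mulrNN mulrC subrr.
move=> /existsNP[i1 /negP]; rewrite -leNgt => qi1.
move=> /existsNP[j1 /negP]; rewrite -leNgt => qj1.
(* Now each side has a queue at or below [tau], so the spread bounds control T itself; |DB| <= nT
   then costs a factor 2n. *)
have sc := sum_spread (lam_spread q j1) qj1.
have ss := sum_spread (mu_spread q i1) qi1.
have T : (qsize q)%:R <= n%:R * (2 * tau + (lam_excess q + mu_excess q) / d).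
  rewrite qsizeE mulrDl; lra.
have := norm_imbalance_busy q; rewrite ler_norml => /andP[+ _].
move: T; rewrite -(ler_pM2l n0).
move: (2 * tau + _) => z; rewrite -mulrA expr2 -!mulrA; lra.
Qed.

Lemma two_price_drift_sqr_size (step : state n -> agent n -> state n) q :
  (forall a, max_weight_move E q a (step q a)) -> complementary E q ->
  drift arr step sqr_size q <=
  eta * W - 2 * eta * (lam_excess q + mu_excess q).
Proof.
move=> mw qE.
have -> : drift arr step sqr_size q = total_rate arr q +
    2 * \sum_a arr q a * ((q a)%:R - (max_compatible E q a)%:R).
  rewrite /drift /total_rate mulr_sumr -big_split; apply: eq_bigr => a _ /=.
  by rewrite (max_weight_sqr_size qE (mw a)); ring.
have ex : lam_excess q + mu_excess q =
    - \sum_a weight a * ((q a)%:R - (max_compatible E q a)%:R).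
  rewrite /lam_excess /mu_excess big_sumType/=.
  under [X in - (X + _)]eq_bigr do rewrite mulrBr.
  under [X in - (_ + X)]eq_bigr do rewrite mulrBr.
  by rewrite !sumrB; ring.
(* A type above the threshold waits, so its compatible queues are empty and lowering its rate can
   only lower the drift. *)
have ar : \sum_a arr q a * ((q a)%:R - (max_compatible E q a)%:R) <=
    eta * \sum_a weight a * ((q a)%:R - (max_compatible E q a)%:R).
  rewrite mulr_sumr; apply: ler_sum => a _; rewrite arrE mulrBl -mulrA gerBl.
  rewrite /busy; case: ltP => [qa|_]; last by rewrite mulr0 mul0r.
  have -> : max_compatible E q a = 0%N.
    apply/eqP; rewrite -leqn0; apply/bigmax_leqP => b ab.
    have [q0|->//] := qE _ _ ab.
    by move: qa; rewrite q0 ltNge tau_ge0.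
  by rewrite subr0 mulr1 mulr_ge0// ltW.
have := total_rate_two_price_le q; rewrite ex; lra.
Qed.

Let c : R := 2 * sigma * n%:R ^+ 2 / (eta * d).

Let c_ge0 : 0 <= c.
Proof.
by apply: divr_ge0; do ?apply: mulr_ge0; rewrite ?exprn_ge0 ?(ltW sigma_gt0)
  ?(ltW eta_gt0) ?(ltW d_gt0).
Qed.

(* The weight c makes the negative drift of [sqr_size] absorb the collapse
   error in the drift of [imbalance ^+ 2]. *)
Definition lyapunov q : R := imbalance q ^+ 2 + c * sqr_size q.

Lemma lyapunov_ge0 q : 0 <= lyapunov q.
Proof.
rewrite addr_ge0 ?sqr_ge0// mulr_ge0//.
by apply: sumr_ge0 => a _; exact: sqr_ge0.
Qed.

(** [collapse] replaces - 2 sigma DB by - 2 sigma nT at the cost of a term in [tau] and one in H;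
    the latter is exactly cancelled by the H term in [c] times the drift of [sqr_size]. *)
Lemma lyapunov_drift (step : state n -> agent n -> state n) q :
  (forall a, max_weight_move E q a (step q a)) -> complementary E q ->
  drift arr step lyapunov q <=
  (eta * W * (1 + c) + 8 * sigma * n%:R ^+ 2 * tau)
  - 2 * sigma * n%:R * (qsize q)%:R.
Proof.
move=> mw qE.
have -> : drift arr step lyapunov q =
    drift arr step (fun q => imbalance q ^+ 2) q + c * drift arr step sqr_size q.
  rewrite /drift mulr_sumr -big_split; apply: eq_bigr => a _ /=.
  by rewrite /lyapunov; ring.
rewrite drift_sqr_imbalance => [|a]; last exact: max_weight_imbalance (mw a).
rewrite side_arr.
have h1 := total_rate_two_price_le q.
have h2 : c * drift arr step sqr_size q <=
    c * (eta * W - 2 * eta * (lam_excess q + mu_excess q)).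
  by rewrite ler_wpM2l ?c_ge0// two_price_drift_sqr_size.
have h3 := collapse qE; rewrite -(ler_pM2l sigma_gt0) in h3.
have h4 : sigma * (2 * n%:R ^+ 2 * ((lam_excess q + mu_excess q) / d)) =
    c * eta * (lam_excess q + mu_excess q).
  by rewrite /c; field; rewrite !gt_eqF.
lra.
Qed.

(** The constant of [lyapunov_drift] divided by [2 * n * eta]: the weight [c] leaves the correction
    in [sigma / eta], the collapse error the one in [sigma * tau / eta]. *)
Lemma two_price_mean_le (step : state n -> agent n -> state n) C p :
  (forall q a, 0 <= arr q a) -> max_weight E step ->
  (forall q, C q -> complementary E q) ->
  stationary_law (chain_rate arr step) C p ->
  ((sigma / eta)%:E * mean p total_queue <=
   (W / (2 * n%:R) * (1 + 2 * n%:R ^+ 2 / d * (sigma / eta)) +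
    4 * n%:R * (sigma * tau / eta))%:E)%E.
Proof.
move=> arr0 mw CE st; have [p0 p1 _ _] := st.
have n0 : 0 < n%:R :> R by rewrite ltr0n.
pose B := eta * W * (1 + c) + 8 * sigma * n%:R ^+ 2 * tau.
have B0 : 0 <= B.
  apply: addr_ge0; last by rewrite !mulr_ge0// ltW.
  apply: mulr_ge0; last by rewrite addr_ge0.
  by apply: mulr_ge0; exact: ltW.
have k0 : 0 < 2 * sigma * n%:R by rewrite !mulr_gt0.
have g0 q : 0 <= 2 * sigma * n%:R * (qsize q)%:R by rewrite mulr_ge0// ltW.
have fh q : C q -> drift arr step lyapunov q <= B - 2 * sigma * n%:R * (qsize q)%:R.
  by move=> Cq; apply: lyapunov_drift; [exact: mw|exact: CE].
have := mean_comparison arr0 total_rate_two_price_le lyapunov_ge0 g0 (fun=> B0) st fh.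
have -> : mean p (fun=> B) = B%:E.
  rewrite /mean -[RHS]mule1 -p1 -esumZ//.
  by apply: eq_esum => q _; rewrite mulrC EFinM.
have -> : mean p (fun q => 2 * sigma * n%:R * (qsize q)%:R) =
    ((2 * sigma * n%:R)%:E * mean p total_queue)%E.
  rewrite /mean -esumZ ?ltW//; last first.
    by move=> q; rewrite lee_fin mulr_ge0// total_queueE.
  by apply: eq_esum => q _; rewrite -EFinM total_queueE mulrCA.
move=> h.
have c1 : 0 < 2 * n%:R * eta by rewrite !mulr_gt0.
have -> : sigma / eta = (2 * n%:R * eta)^-1 * (2 * sigma * n%:R).
  by field; rewrite !gt_eqF.
rewrite EFinM -muleA lee_pdivrMl//; apply: le_trans h _.
rewrite -EFinM lee_fin le_eqVlt; apply/orP; left; apply/eqP.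
by rewrite /B /c; field; rewrite !gt_eqF.
Qed.

End TwoPrice.

(** * Stability of max-weight matching *)

Section MaxWeightChain.
Context {R : realType} {n : nat} (E : {set 'I_n * 'I_n}).
Context (arr : state n -> agent n -> R) (step : state n -> agent n -> state n).
Implicit Types (q : state n) (a b : agent n).
Hypothesis mw : max_weight E step.
Hypothesis arr_gt0 : forall q a, 0 < arr q a.

Let r := chain_rate arr step.

Let arr0 q a : 0 <= arr q a. Proof. exact: ltW. Qed.

Let empty_state : state n := [ffun=> 0%N].

(** Each move changes the size by exactly one; without self-loops the exit rate is [total_rate]. *)
Lemma step_neq q a : step q a != q.
Proof.
apply/eqP => /(congr1 qsize).
case: (mw q a) => [[b [_ qb _ ->]]|[_ ->]].
  by move: (qsize_remove_agent qb) => <- /eqP; rewrite -[X in X == _]addn0 -addn1 eqn_add2l.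
by rewrite qsize_add_agent => /eqP; rewrite -[X in _ == X]addn0 -addn1 eqn_add2l.
Qed.

Lemma jump_rel_step q a : jump_rel r q (step q a).
Proof.
rewrite /jump_rel step_neq /r /chain_rate (bigD1 a)//=.
by rewrite ltr_pwDl// sumr_ge0.
Qed.

Lemma reaches_complementary q q' :
  complementary E q -> reaches r q q' -> complementary E q'.
Proof.
move=> qE; move: q'; apply: reaches_ind => // y z _ yE /andP[_ ryz].
have [a /eqP <-] : exists a, step y a == z.
  apply/existsP; apply: contraTT ryz => /existsPn nz.
  by rewrite /r /chain_rate big_pred0 ?ltxx// => a; exact/negbTE.
exact: max_weight_complementary (mw y a).
Qed.

Lemma unit_state_complementary a : complementary E (unit_state a).
Proof.
move=> b c bc; rewrite !ffunE; have [ba|] := eqVneq b a; last by left.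
have [ca|] := eqVneq c a; last by right.
by move: bc; rewrite ba ca; case: (a).
Qed.

Lemma step_empty_state a : step empty_state a = unit_state a.
Proof.
case: (mw empty_state a) => [[b [_ + _ _]]|[_ ->]]; first by rewrite ffunE.
by apply/ffunP => b; rewrite !ffunE add0n.
Qed.

Hypothesis neighbor : forall a, exists b, compatible E a b.

(** While some [a] waits, an arrival compatible with [a] is matched at once and lowers the size. *)
Lemma reaches_empty_state q : reaches r q empty_state.
Proof.
have [m] := ubnP (qsize q); elim: m q => // m IH q qm.
have [[a qa]|q0] := pselect (exists a, (0 < q a)%N); last first.
  have -> : q = empty_state; last exact: reaches_refl.
  apply/ffunP => a; rewrite ffunE; apply/eqP; rewrite -leqn0 leqNgt.
  by apply/negP => qa; apply: q0; exists a.
have [b ab] := neighbor a.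
apply: reaches_trans (reaches1 (jump_rel_step q b)) _.
apply: IH; case: (mw q b) => [[c [_ qc _ ->]]|[/(_ a)]].
  by rewrite -ltnS qsize_remove_agent.
by rewrite compatible_sym => /(_ ab) q0; rewrite q0 in qa.
Qed.

(** The class is the set of states reachable from the empty one; it communicates because every state
    leads back there. The stationary law is positive throughout it, whence recurrence. *)
Lemma max_weight_stable (f : state n -> R) (L B c : R) : (0 < n)%N ->
  0 < L -> (forall q, total_rate arr q <= L) -> (forall q, 0 <= f q) -> 0 < c ->
  (forall q, complementary E q -> drift arr step f q <= B - c * (qsize q)%:R) ->
  exists C p, stable_class r C /\ stationary_law r C p.
Proof.
move=> n_gt0 L0 arrL f0 c0 fd; pose C := [set q | reaches r empty_state q].
have CE q : C q -> complementary E q.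
  by apply: reaches_complementary => a b _; left; rewrite ffunE.
have Cstep q a : C q -> C (step q a).
  move=> Cq; apply: reaches_trans Cq _; apply: reaches1; exact: jump_rel_step.
have [|p st] := @stationary_law_exists R n arr step C empty_state f L B c
    arr0 arrL L0 (reaches_refl _ _) Cstep f0 c0 (fun q Cq => fd q (CE q Cq)).
  by move=> q a; exact: max_weight_size (mw q a).
exists C, p; split => //.
have rd q : r q q = 0.
  by rewrite /r /chain_rate big_pred0// => a; exact/negbTE/step_neq.
have eE q : exit_rate r q = (total_rate arr q)%:E.
  by rewrite /r exit_rateE// -/r rd subr0.
have e0 q : 0 < total_rate arr q.
  rewrite /total_rate (bigD1 (inl (Ordinal n_gt0)))//=.
  by rewrite ltr_pwDl// sumr_ge0.
have r0 := chain_rate_ge0 step arr0.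
split.
- exists empty_state; apply/seteqP; split=> q /=; last by case.
  by move=> Cq; split=> //; exact: reaches_empty_state.
- move=> q Cq; apply: (stationary_law_recurrent r0 eE e0 st).
  have [x Cx px] := stationary_law_ex_gt0 st.
  apply: (stationary_law_gt0 st px).
  exact: reaches_trans (reaches_empty_state x) Cq.
- exists (Ordinal n_gt0); rewrite /C/= -step_empty_state.
  exact/reaches1/jump_rel_step.
Qed.

End MaxWeightChain.

(** * Proof of the lower bound and of the limit *)

(** The class contains a unit state, which is complementary, and all its states are reachable from
    there. *)
Lemma stable_class_complementary (R : realType) (n : nat) (E : {set 'I_n * 'I_n})
    (arr : state n -> agent n -> R) step C q :
  max_weight E step -> stable_class (chain_rate arr step) C -> C q ->
  complementary E q.
Proof.
move=> mw [[x ->] _ [j [xu ux]]] [xq _].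
have uE : complementary E (unit_state (inl j)) by exact: unit_state_complementary.
refine (reaches_complementary mw uE (reaches_trans ux xq)).
Qed.

(** Row and column sums of [y q] have the same total, so the matched agents cancel. *)
Lemma policy_step_imbalance (R : realType) (n : nat) (E : {set 'I_n * 'I_n})
    (y : state n -> 'M[nat]_n) q a :
  matching_policy E y ->
  imbalance (policy_step y q a) = imbalance q + side a :> R.
Proof.
move=> /(_ q)[yq _]; rewrite -imbalance_add_agent.
have -> : imbalance (policy_step y q a) = imbalance (add_agent q a)
    - \sum_b side b * (matched (y q) b)%:R :> R.
  rewrite /imbalance -sumrB; apply: eq_bigr => b _.
  rewrite [policy_step _ _ _ _]ffunE natrB ?mulrBr//.
  by rewrite ffunE (leq_trans (yq b))// leq_addr.
rewrite big_sumType/=; under eq_bigr do rewrite mul1r.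
under [X in _ - (_ + X)]eq_bigr do rewrite mulN1r.
by rewrite sumrN -!natr_sum exchange_big/= subrr subr0.
Qed.

Lemma perfect_matching_neighbor (n : nat) (E : {set 'I_n * 'I_n}) a :
  perfect_matching E -> exists b, compatible E a b.
Proof.
move=> [s sE]; case: a => [j|i]; last by exists (inl (s i)); exact: sE.
by exists (inr ((s^-1)%g j)) => /=; rewrite -{2}[j](permKV s) sE.
Qed.

Theorem proposition6 (R : realType) (n : nat) (n_gt0 : (0 < n)%N)
    (E : {set 'I_n * 'I_n}) (E_matching : perfect_matching E)
    (F G : 'I_n -> R -> R) (FG_curves : price_curves F G)
    (lam mu : 'I_n -> R) (chi : 'M[R]_n)
    (fluid : fluid_optimal E F G lam mu chi)
    (lam_gt0 : forall j, 0 < lam j) (mu_gt0 : forall i, 0 < mu i)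
    (sigma tau : nat -> R)
    (sigma_gt0 : forall eta, 0 < sigma eta)
    (tau_ge0 : forall eta, 0 <= tau eta) :
  let arrivals (eta : nat) := two_price lam mu eta%:R (sigma eta) (tau eta) in
  let limit : R := (\sum_j lam j + \sum_i mu i) / (2 * n%:R) in
  (forall (eta : nat) (y : state n -> 'M[nat]_n)
      (C : set (state n)) (p : state n -> R),
    let r := chain_rate (arrivals eta) (policy_step y) in
    (forall q a, 0 <= arrivals eta q a) ->
    matching_policy E y ->
    stable_class r C ->
    stationary_law r C p ->
    ((limit - sigma eta / eta%:R)%:E
       <= (sigma eta / eta%:R)%:E * mean p total_queue)%E)
  /\
  (resource_pooling E lam mu ->
   forall step : nat -> state n -> agent n -> state n,
    (forall eta, max_weight E (step eta)) ->
    (fun eta => sigma eta / eta%:R) @ \oo --> (0 : R) ->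
    (fun eta => sigma eta * tau eta / eta%:R) @ \oo --> (0 : R) ->
    let r (eta : nat) := chain_rate (arrivals eta) (step eta) in
    (\forall eta \near \oo, exists C p,
        stable_class (r eta) C /\ stationary_law (r eta) C p) /\
    (forall (C : nat -> set (state n)) (p : nat -> state n -> R),
      (\forall eta \near \oo,
          stable_class (r eta) (C eta) /\
          stationary_law (r eta) (C eta) (p eta)) ->
      (fun eta => ((sigma eta / eta%:R)%:E * mean (p eta) total_queue)%E)
        @ \oo --> limit%:E)).
Proof.
move=> arrivals limit.
have balanced : \sum_j lam j = \sum_i mu i.
  have [[lamE muE _ _] _] := fluid.
  rewrite (eq_bigr _ (fun j _ => lamE j)) exchange_big.
  by apply: eq_bigr => i _; rewrite muE.
pose weight a : R := match a with inl j => lam j | inr i => mu i end.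
have weight_gt0 a : 0 < weight a by case: a.
split=> [eta y C p r arr0 yE _ st|].
  have eta_gt0 : 0 < eta%:R :> R.
    rewrite ltr0n lt0n; apply/eqP => eta0.
    (* With all queues above the threshold and [eta = 0], every rate would be [- sigma eta < 0]. *)
    pose q : state n := [ffun=> (Num.truncn (tau eta)).+1].
    have := arr0 q (inl (Ordinal n_gt0)).
    rewrite /arrivals /two_price ffunE truncnS_gt eta0 mul0r mulr1 add0r oppr_ge0.
    by rewrite leNgt sigma_gt0.
  apply: (two_price_mean_ge n_gt0 balanced eta_gt0 (sigma_gt0 eta) arr0 st).
  by move=> q a _; exact: policy_step_imbalance yE.
move=> pooling step mw sigma0 sigmatau0 r.
have [d d_gt0 [lam_gap mu_gap]] := resource_pooling_gap pooling.
have [w0 w0_gt0 w0_le] := @finite_gap R _ predT weight (fun a _ => weight_gt0 a).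
have neighbor a := perfect_matching_neighbor a E_matching.
(* Once [sigma eta / eta] is below the least fluid rate [w0], all arrival rates are positive. *)
have large : \forall eta \near \oo, 0 < eta%:R :> R /\
    forall q a, 0 < arrivals eta q a.
  near=> eta.
  have eta_gt0 : 0 < eta%:R :> R.
    by rewrite ltr0n; near: eta; exact: nbhs_infty_gt.
  split=> // q a.
  have : sigma eta / eta%:R < w0 by near: eta; exact: cvgr_lt sigma0 _ w0_gt0.
  rewrite ltr_pdivrMr// => sw.
  have : sigma eta * (tau eta < (q a)%:R)%R%:R < eta%:R * weight a.
    apply: (@le_lt_trans _ _ (sigma eta)).
      by rewrite ler_piMr ?lern1 ?leq_b1 ?(ltW (sigma_gt0 _)).
    by apply: lt_le_trans sw _; rewrite mulrC ler_wpM2l// w0_le.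
  by rewrite /arrivals /two_price subr_gt0.
have W_gt0 : 0 < \sum_j lam j + \sum_i mu i.
  rewrite (bigD1 (Ordinal n_gt0))//= -addrA ltr_pwDl// addr_ge0// sumr_ge0//.
  - by move=> j _; exact: ltW.
  - by move=> i _; exact: ltW.
split.
  apply: filterS large => eta [eta_gt0 arr_gt0].
  have fd q := lyapunov_drift n_gt0 balanced weight_gt0 eta_gt0 (sigma_gt0 eta)
    (tau_ge0 eta) neighbor d_gt0 lam_gap mu_gap (mw eta q).
  apply: (max_weight_stable (mw eta) arr_gt0 neighbor n_gt0
    (mulr_gt0 eta_gt0 W_gt0) _ _ _ fd).
  - exact: total_rate_two_price_le.
  - exact: lyapunov_ge0.
  - by rewrite !mulr_gt0// ltr0n.
move=> C p Cp.
apply: (@squeeze_cvge _ _ _ _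
  (fun eta => (limit - sigma eta / eta%:R)%:E) _
  (fun eta => (limit * (1 + 2 * n%:R ^+ 2 / d * (sigma eta / eta%:R)) +
    4 * n%:R * (sigma eta * tau eta / eta%:R))%:E)).
- near=> eta.
  have [eta_gt0 arr_gt0] : 0 < eta%:R :> R /\ forall q a, 0 < arrivals eta q a.
    by near: eta.
  have arr0 q a : 0 <= arrivals eta q a by exact: ltW.
  have [stab st] : stable_class (r eta) (C eta) /\
    stationary_law (r eta) (C eta) (p eta) by near: eta.
  apply/andP; split.
    apply: (two_price_mean_ge n_gt0 balanced eta_gt0 (sigma_gt0 eta) arr0 st).
    by move=> q a _; exact: max_weight_imbalance (mw eta q a).
  apply: (two_price_mean_le n_gt0 balanced weight_gt0 eta_gt0 (sigma_gt0 eta)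
    (tau_ge0 eta) neighbor d_gt0 lam_gap mu_gap arr0 (mw eta) _ st) => q.
  exact: stable_class_complementary (mw eta) stab.
- apply: cvg_EFin; first exact: nearW.
  by rewrite -[X in _ --> X]subr0; apply: cvgB => //; exact: cvg_cst.
- apply: cvg_EFin; first exact: nearW.
  (* [limit] is rewritten as the upper bound with both vanishing ratios set to 0. *)
  rewrite [X in _ --> X](_ : limit =
    limit * (1 + 2 * n%:R ^+ 2 / d * 0) + 4 * n%:R * 0); last by ring.
  apply: cvgD; last exact: cvgMr.
  by apply: cvgMr; apply: cvgD; [exact: cvg_cst|exact: cvgMr].
Unshelve. all: by end_near. Qed.
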